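(* Let $\mu$ be an $\mathfrak a_m$-dominant $\mathfrak a_m$-integral weight and $1\le i\le m$. Then the Casimir element $\Omega_{\mathfrak a_m}$ acts non-semisimply on the injective module $I(\mu[i])$ of $\mathcal O^{\mathfrak b_m}(\mathfrak a_m)$.
   Context: $\mathfrak a_m=\mathrm{Span}\{\partial_{x_i},x_j\partial_{x_i},x_jE_x\}\cong\mathfrak{sl}_{m+1}$ with $E_x=\sum_rx_r\partial_{x_r}$ (polynomial vector fields on $\mathbb R^m$), $\mathfrak b_m=\mathrm{Span}\{\partial_{x_i},x_j\partial_{x_i}\}$, $\mathfrak c_m=\mathrm{Span}\{\partial_{x_i}\}$, $\mathfrak l_m=\mathrm{Span}\{x_j\partial_{x_i}\}\cong\mathfrak{gl}_m$, $\mathfrak h_m=\mathrm{Span}\{x_i\partial_{x_i}\}$. Weights $\lambda=\sum_{i=0}^m\lambda_i\epsilon_i$, $\sum\lambda_i=0$, $\lambda(x_j\partial_{x_j})=\lambda_j$; positive root vectors $\partial_{x_i}$ and $x_i\partial_{x_j}$ ($i<j$); $\mathfrak a_m$-dominant integral means $\lambda_i-\lambda_{i+1}\in\mathbb N$ for $0\le i<m$. $\rho=\sum_i(\tfrac m2-i)\epsilon_i$; for $1\le i\le m$ and $\sigma=\mu+\rho$, $\mu[i]$ is defined by $\mu[i]+\rho=(\sigma_i,\sigma_0,\dots,\sigma_{i-1},\sigma_{i+1},\dots,\sigma_m)$. $\Omega_{\mathfrak a_m}=\sum_{i,j}(x_i\partial_{x_j})(x_j\partial_{x_i})+E_x(E_x-m-1)-2\sum_i(x_iE_x)(\partial_{x_i})\in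 U(\mathfrak a_m)$. $\mathcal O^{\mathfrak b_m}(\mathfrak a_m)$: finitely generated $\mathfrak a_m$-modules that are direct sums of finite-dimensional irreducible $\mathfrak l_m$-modules with $\mathfrak c_m$ acting locally nilpotently; $I(\lambda)$ is the injective envelope in this category of the irreducible $\mathfrak a_m$-module of highest weight $\lambda$. *)

(* Defs.v *)
(* Lie algebra a_m realised as sl_{m+1} (traceless
   (m+1)x(m+1) real matrices) through an explicit isomorphism with the
   polynomial vector fields of the paper. *)
From HB Require Import structures.
From mathcomp Require Import all_boot all_order all_algebra.
From mathcomp Require Import reals.
Set Implicit Arguments. Unset Strict Implicit. Unset Printing Implicit Defensive.
Import Order.TTheory GRing.Theory Num.Theory.
Local Open Scope ring_scope.

Section AmDefs.
Variable R : realType.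
Variable m : nat.

Definition Mat := 'M[R]_(m.+1).
Definition slm (A : Mat) : Prop := \tr A = 0.

(* indices: paper's x_1..x_m  <->  a : 'I_m  (paper index a+1), and the
   matrix index 0 is the extra index of sl_{m+1}. *)
Definition Eij (a b : 'I_(m.+1)) : Mat := delta_mx a b.
(* the vector field d/dx_i *)
Definition vf_d (i : 'I_m) : Mat := Eij 0 (lift ord0 i).
(* the vector field x_a d/dx_b *)
Definition vf_xd (a b : 'I_m) : Mat :=
  Eij (lift ord0 a) (lift ord0 b) - (if a == b then ((m.+1)%:R^-1)%:M else 0).
Definition vf_E : Mat := \sum_(a < m) vf_xd a a.
(* the vector field x_a E_x *)
Definition vf_xE (a : 'I_m) : Mat := - Eij (lift ord0 a) 0.

Record amod := AMod {
  amV : lmodType R;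
  act : Mat -> amV -> amV;
  act_linV : forall A, slm A -> forall (a : R) (u v : amV),
      act A (a *: u + v) = a *: act A u + act A v;
  act_linA : forall A B, slm A -> slm B -> forall (a : R) (v : amV),
      act (a *: A + B) v = a *: act A v + act B v;
  act_br : forall A B, slm A -> slm B -> forall v : amV,
      act (A *m B - B *m A) v = act A (act B v) - act B (act A v) }.
Arguments act : clear implicits.

Definition subspace (V : lmodType R) (S : V -> Prop) : Prop :=
  S 0 /\ (forall (a : R) u v, S u -> S v -> S (a *: u + v)).

Definition submod (M : amod) (S : amV M -> Prop) : Prop :=
  subspace S /\ (forall A, slm A -> forall v, S v -> S (act M A v)).

Definition lsubmod (M : amod) (S : amV M -> Prop) : Prop :=
  subspace S /\ (forall a b v, S v -> S (act M (vf_xd a b) v)).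

Definition fin_dim (V : lmodType R) (S : V -> Prop) : Prop :=
  exists s : seq V, (forall x, x \in s -> S x) /\
    (forall w, S w -> exists c : 'I_(size s) -> R,
        w = \sum_(k < size s) c k *: nth 0 s k).

Definition nonzero_sp (V : lmodType R) (S : V -> Prop) : Prop :=
  exists x, S x /\ x != 0.

Definition l_irred (M : amod) (W : amV M -> Prop) : Prop :=
  lsubmod W /\ nonzero_sp W /\
  forall U : amV M -> Prop, lsubmod U -> (forall x, U x -> W x) ->
    (forall x, U x -> x = 0) \/ (forall x, W x -> U x).

Definition l_fd_semisimple (M : amod) : Prop :=
  exists (K : Type) (W : K -> amV M -> Prop),
    (forall k, fin_dim (W k) /\ l_irred (W k)) /\
    (forall v, exists (n : nat) (ks : 'I_n -> K) (w : 'I_n -> amV M),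
        injective ks /\ (forall t, W (ks t) (w t)) /\ v = \sum_(t < n) w t) /\
    (forall (n : nat) (ks : 'I_n -> K) (w : 'I_n -> amV M),
        injective ks -> (forall t, W (ks t) (w t)) ->
        \sum_(t < n) w t = 0 -> forall t, w t = 0).

Definition c_locnil (M : amod) : Prop :=
  forall v : amV M, exists n : nat, forall s : seq 'I_m, size s = n ->
    foldr (fun i x => act M (vf_d i) x) v s = 0.

Definition fin_gen (M : amod) : Prop :=
  exists s : seq (amV M), forall S : amV M -> Prop, submod S -> (forall x, x \in s -> S x) ->
    forall v, S v.

Definition inO (M : amod) : Prop :=
  fin_gen M /\ l_fd_semisimple M /\ c_locnil M.

Definition amhom (M N : amod) (f : amV M -> amV N) : Prop :=
  (forall (a : R) u v, f (a *: u + v) = a *: f u + f v) /\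
  (forall A, slm A -> forall v, f (act M A v) = act N A (f v)).

Definition inj_obj (I : amod) : Prop :=
  inO I /\
  forall (M N : amod) (f : amV M -> amV N) (g : amV M -> amV I),
    inO M -> inO N -> amhom f -> injective f -> amhom g ->
    exists h : amV N -> amV I, amhom h /\ forall v, h (f v) = g v.

Definition simple_mod (M : amod) : Prop :=
  nonzero_sp (fun _ : amV M => True) /\
  forall S : amV M -> Prop, submod S -> (forall x, S x -> x = 0) \/ (forall x, S x).

Definition weight := 'I_(m.+1) -> R.

Definition has_hw (M : amod) (lam : weight) : Prop :=
  exists v : amV M, v != 0 /\
    (forall a, act M (vf_xd a a) v = lam (lift ord0 a) *: v) /\
    (forall i, act M (vf_d i) v = 0) /\
    (forall a b : 'I_m, (a < b)%N -> act M (vf_xd a b) v = 0).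

Definition essential (L I : amod) (j : amV L -> amV I) : Prop :=
  forall S : amV I -> Prop, submod S -> nonzero_sp S -> exists y, y != 0 /\ S (j y).

Definition is_weight (lam : weight) : Prop := \sum_(k < m.+1) lam k = 0.

Definition dom_int (lam : weight) : Prop :=
  forall k : 'I_m, exists n : nat,
    lam (widen_ord (leqnSn m) k) - lam (lift ord0 k) = n%:R.

Definition rho : weight := fun k => (m%:R / 2%:R) - (k : nat)%:R.

(* mu[i] for the paper's index i = (val i).+1 in 1..m *)
Definition shift_wt (mu : weight) (i : 'I_m) : weight :=
  fun k => let ii := (val i).+1 in
    let src := if (k : nat) == 0%N then ii
               else if (k <= ii)%N then (k : nat).-1 else (k : nat) in
    (mu (inord src) + rho (inord src)) - rho k.

Definition Omega (M : amod) (v : amV M) : amV M :=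
  \sum_(a < m) \sum_(b < m) act M (vf_xd a b) (act M (vf_xd b a) v)
  + act M vf_E (act M vf_E v - (m.+1)%:R *: v)
  - 2%:R *: \sum_(a < m) act M (vf_xE a) (act M (vf_d a) v).

Definition Omega_semisimple (M : amod) : Prop :=
  forall v : amV M, exists (n : nat) (c : 'I_n -> R) (w : 'I_n -> amV M),
    (forall t, Omega (w t) = c t *: w t) /\ v = \sum_(t < n) w t.

End AmDefs.
Arguments act {R m} _ _ _.

(* Main.v *)
Require Import Defs.
From HB Require Import structures.
From mathcomp Require Import all_boot all_order all_algebra.
From mathcomp Require Import reals boolp perm.
From mathcomp Require Import mpoly ring.
(* Let X be an object of O and w in X a highest weight vector of weight mu[i], so
   that L is a quotient of the submodule M generated by w. If x in X satisfies
   (Omega - c) x = al w with al <> 0, where Omega w = c w, then M is contained in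
   the submodule N generated by x, the map M -> L -> I extends to N by
   injectivity, and the image of x in I exhibits a Jordan block of Omega.

   Such an X is found among polynomials: polynomials in x with coefficients in
   the polynomials in xi and y, on which x_a d/dx_b acts by x_a d/dx_b
   - xi_b d/dxi_a + sum_k y_ak d/dy_bk + mu_m delta_ab and where the isotropy
   vector fields x_a E_x act, besides their usual first order terms, by d/dxi_a.
   Let w be a product of leading minors of (y_ak) in which the i-th minor p
   occurs at least n = sigma_(i-1) - sigma_i times, sigma = mu + rho. Replacing
   the last row of p by sum_e xi_e y_e gives a polynomial s, and
   w_k = x_i^k s^k p^(-k) w satisfies
     Omega w_k = (c + 2k(k - n)) w_k - 2k^2 w_(k-1).
   The value c recurs at k = n (this is the linkage between mu[i-1] and mu[i]),
   and descending from w_n yields x.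

   Complete reducibility over gl_m comes from the Fischer inner product of
   polynomials, for which x_a d/dx_b and x_b d/dx_a are adjoint. *)
Set Implicit Arguments. Unset Strict Implicit. Unset Printing Implicit Defensive.
Import Order.TTheory GRing.Theory Num.Theory.
Local Open Scope ring_scope.

(** * Modules over a_m *)

(** The module I is accessible only through injectivity, which is tested on objects of O, so the
    Jordan block is built elsewhere and transported. Tensor fields with an irreducible fibre on
    which the isotropy fields x_a E_x act trivially form a coinduced module, and there the central
    element Omega is a scalar. Hence the fibre has to carry a nonzero action of these fields; they
    commute with one another and transform under gl_m as the d/dxi_a do, which is the reason for the
    variables xi. The whole model contains infinitely many y-degrees and is not finitely generated.
    Its cyclic submodules are, and an anisotropic form restricts to any submodule; over the reals
    anisotropy comes from positivity. The twist by mu_m is there because mu_m may be negative or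
    non-integral, out of reach of products of minors. The vectors w_k share one weight because x_i s
    has the weight of p, and d/dxi_i s = p is what links w_k to w_(k-1). *)

Section ActTheory.
Variables (R : realType) (m : nat) (M : amod R m).
Implicit Types (A B : Mat R m) (u v : amV M).

Lemma slm0 : slm (0 : Mat R m). Proof. exact: mxtrace0. Qed.

Lemma slmP a A B : slm A -> slm B -> slm (a *: A + B).
Proof. by rewrite /slm => hA hB; rewrite mxtraceD mxtraceZ hA hB mulr0 addr0. Qed.

Lemma slmZ a A : slm A -> slm (a *: A).
Proof. by rewrite /slm => hA; rewrite mxtraceZ hA mulr0. Qed.

Lemma slmD A B : slm A -> slm B -> slm (A + B).
Proof. by rewrite /slm => hA hB; rewrite mxtraceD hA hB addr0. Qed.

Lemma slm_sum (J : Type) (r : seq J) (F : J -> Mat R m) :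
  (forall k, slm (F k)) -> slm (\sum_(k <- r) F k).
Proof. by move=> hF; elim/big_ind: _ => //; [exact: slm0 | exact: slmD]. Qed.

Lemma slm_comm A B : slm (A *m B - B *m A).
Proof. by rewrite /slm mxtraceD linearN /= mxtrace_mulC subrr. Qed.

Lemma slm_Eij (a b : 'I_m.+1) : a != b -> slm (Eij R a b).
Proof.
rewrite /slm /Eij /mxtrace => ab; rewrite big1 // => k _; rewrite mxE.
by case: eqP => //= ->; rewrite (negbTE ab).
Qed.

Lemma trEii (a : 'I_m.+1) : \tr (Eij R a a) = 1.
Proof.
rewrite /mxtrace /Eij (bigD1 a) //= mxE !eqxx big1 ?addr0 // => k ka.
by rewrite mxE (negbTE ka).
Qed.

Lemma slm_xd (a b : 'I_m) : slm (vf_xd R a b).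
Proof.
rewrite /vf_xd; case: eqP => [->|/eqP ab]; last first.
  by rewrite subr0; apply: slm_Eij; rewrite (inj_eq lift_inj).
by rewrite /slm linearB /= trEii mxtrace_scalar -(mulr_natr (m.+1%:R^-1)) mulVf ?subrr // pnatr_eq0.
Qed.

Lemma slm_d (b : 'I_m) : slm (vf_d R b). Proof. exact: slm_Eij. Qed.

Lemma slm_xE (a : 'I_m) : slm (vf_xE R a).
Proof. by rewrite /vf_xE -scaleN1r; apply/slmZ/slm_Eij. Qed.

Lemma slm_E : slm (vf_E R m).
Proof. by apply: slm_sum => a; exact: slm_xd. Qed.

Lemma actD A : slm A -> {morph act M A : u v / u + v}.
Proof. by move=> hA u v; have := act_linV hA 1 u v; rewrite !scale1r. Qed.

Lemma act0 A : slm A -> act M A 0 = 0.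
Proof. by move=> hA; apply: (addrI (act M A 0)); rewrite -actD // !addr0. Qed.

Lemma actZ A : slm A -> forall a u, act M A (a *: u) = a *: act M A u.
Proof. by move=> hA a u; have := act_linV hA a u 0; rewrite act0 // !addr0. Qed.

Lemma actN A : slm A -> {morph act M A : u / - u}.
Proof. by move=> hA u; rewrite -scaleN1r actZ // scaleN1r. Qed.

Lemma act_sum A (J : Type) (r : seq J) (P : pred J) (F : J -> amV M) : slm A ->
  act M A (\sum_(k <- r | P k) F k) = \sum_(k <- r | P k) act M A (F k).
Proof. by move=> hA; apply: (big_morph _ (actD hA) (act0 hA)). Qed.

Lemma actA0 v : act M 0 v = 0.
Proof.
have := act_linA slm0 slm0 1 v; rewrite !scale1r addr0 => h.
by apply: (addrI (act M 0 v)); rewrite addr0.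
Qed.

Lemma actAD A B v : slm A -> slm B -> act M (A + B) v = act M A v + act M B v.
Proof. by move=> hA hB; have := act_linA hA hB 1 v; rewrite !scale1r. Qed.

Lemma actAZ a A v : slm A -> act M (a *: A) v = a *: act M A v.
Proof. by move=> hA; have := act_linA hA slm0 a v; rewrite actA0 !addr0. Qed.

Lemma actA_sum (J : Type) (r : seq J) (F : J -> Mat R m) v : (forall k, slm (F k)) ->
  act M (\sum_(k <- r) F k) v = \sum_(k <- r) act M (F k) v.
Proof.
move=> hF; elim: r => [|k r IH]; first by rewrite !big_nil actA0.
by rewrite !big_cons actAD ?IH //; apply: slm_sum.
Qed.

(** Each [vf_xd a a] contains a multiple of the identity. Subtracting [A 0 0] from the diagonal
    coefficients compensates for it: as the trace vanishes, these identity parts add up to [A 0 0]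
    times the identity. *)
Lemma slm_decomp A : slm A ->
  A = \sum_a \sum_b (A (lift ord0 a) (lift ord0 b) - (if a == b then A 0 0 else 0)) *: vf_xd R a b
    + \sum_b A 0 (lift ord0 b) *: vf_d R b
    - \sum_a A (lift ord0 a) 0 *: vf_xE R a.
Proof.
have m1 : (m.+1)%:R != 0 :> R by rewrite pnatr_eq0.
move=> hA; have {hA} : A 0 0 = - \sum_(k < m) A (lift ord0 k) (lift ord0 k).
  by move: hA; rewrite /slm /mxtrace big_ord_recl => /eqP; rewrite addr_eq0 => /eqP.
move=> hA; apply/matrixP => p q; rewrite !mxE !summxE.
under eq_bigr do rewrite summxE.
have e1 : \sum_(k < m) (A (lift ord0 k) (lift ord0 k) - A 0 0) = - (m.+1)%:R * A 0 0.
  rewrite big_split /= sumrN sumr_const card_ord -[\sum_(k < m) A _ _]opprK -hA.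
  by rewrite -mulr_natl -(natr1 m); ring.
have e2 : forall p q : 'I_m.+1,
    \sum_(k < m) \sum_(l < m)
      ((A (lift ord0 k) (lift ord0 l) - (if k == l then A 0 0 else 0)) *: vf_xd R k l) p q
  = \sum_(k < m) \sum_(l < m)
      (A (lift ord0 k) (lift ord0 l) - (if k == l then A 0 0 else 0)) * (Eij R (lift ord0 k) (lift ord0 l) p q)
    + (p == q)%:R * A 0 0.
  move=> {}p {}q.
  have -> : (p == q)%:R * A 0 0 = - ((m.+1)%:R^-1 * \sum_(k < m) (A (lift ord0 k) (lift ord0 k) - A 0 0)) * (p == q)%:R.
    by rewrite e1 mulNr mulrN opprK mulKf // mulrC.
  rewrite mulr_sumr -sumrN mulr_suml -big_split; apply: eq_bigr => k _ /=.
  rewrite (bigD1 k) //= [in RHS](bigD1 k) //= eqxx !mxE eqxx /=.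
  under eq_bigr => l lk do rewrite !mxE eq_sym (negbTE lk) mxE subr0 oppr0 addr0.
  rewrite ?mxE -[(m.+1%:R^-1 *+ _)]mulr_natr.
  under [in RHS]eq_bigr => l lk do rewrite !mxE eq_sym (negbTE lk) subr0.
  by ring.
rewrite e2.
case: (unliftP ord0 p) => [p'|] ->; case: (unliftP ord0 q) => [q'|] ->.
- rewrite (inj_eq lift_inj) (bigD1 p') //= (bigD1 q') //= !mxE !eqxx /=.
  rewrite [X in _ = _ + X + _ + _ - _]big1 => [|k kp]; last first.
    by rewrite big1 // => l _; rewrite !mxE (inj_eq lift_inj) [p' == _]eq_sym (negbTE kp) mulr0.
  rewrite [X in _ = _ + X + _ + _ + _ - _]big1 => [|l lq]; last first.
    by rewrite !mxE !(inj_eq lift_inj) eqxx [q' == _]eq_sym (negbTE lq) mulr0.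
  rewrite [X in _ = _ + X - _]big1 => [|k _]; last by rewrite !mxE mulr0.
  rewrite [X in _ = _ - X]big1 => [|k _]; last by rewrite !mxE andbF oppr0 mulr0.
  by case: eqP => _ /=; ring.
- rewrite [X in _ = X + _ + _ - _]big1 => [|k _]; last first.
    by rewrite big1 // => l _; rewrite !mxE andbF mulr0.
  rewrite [X in _ = _ + X - _]big1 => [|k _]; last by rewrite !mxE mulr0.
  rewrite (bigD1 p') //= big1 => [|k kp]; last first.
    by rewrite !mxE (inj_eq lift_inj) [p' == _]eq_sym (negbTE kp) oppr0 mulr0.
  by rewrite !mxE !eqxx /=; ring.
- rewrite [X in _ = X + _ + _ - _]big1 => [|k _]; last first.
    by rewrite big1 // => l _; rewrite !mxE mulr0.
  rewrite [X in _ = _ - X]big1 => [|k _]; last by rewrite !mxE andbF oppr0 mulr0.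
  rewrite (bigD1 q') //= [X in _ = _ + (_ + X) - _]big1 => [|k kq]; last first.
    by rewrite !mxE (inj_eq lift_inj) [q' == _]eq_sym (negbTE kq) andbF mulr0.
  by rewrite !mxE !eqxx /=; ring.
- rewrite [X in _ = X + _ + _ - _]big1 => [|k _]; last first.
    by rewrite big1 // => l _; rewrite !mxE mulr0.
  rewrite [X in _ = _ + X - _]big1 => [|k _]; last by rewrite !mxE andbF mulr0.
  rewrite big1 => [|k _]; last by rewrite !mxE oppr0 mulr0.
  by rewrite eqxx /=; ring.
Qed.

Lemma act_decomp A v : slm A ->
  act M A v =
    \sum_a \sum_b (A (lift ord0 a) (lift ord0 b) - (if a == b then A 0 0 else 0)) *: act M (vf_xd R a b) v
    + \sum_b A 0 (lift ord0 b) *: act M (vf_d R b) v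
    - \sum_a A (lift ord0 a) 0 *: act M (vf_xE R a) v.
Proof.
have sxd a b := slm_xd a b; have sd b := slm_d b; have sE a := slm_xE a.
move=> /slm_decomp hA; rewrite [in LHS]hA -(scaleN1r (\sum_a A (lift ord0 a) 0 *: vf_xE R a)) actAD; last 2 first.
- by apply: slmD; [apply: slm_sum => a; apply: slm_sum => b|apply: slm_sum => b]; apply: slmZ.
- by apply: slmZ; apply: slm_sum => a; apply: slmZ.
rewrite actAZ; last by apply: slm_sum => a; apply: slmZ.
rewrite scaleN1r actAD; last 2 first.
- by apply: slm_sum => a; apply: slm_sum => b; apply: slmZ.
- by apply: slm_sum => b; apply: slmZ.
rewrite !actA_sum; try by move=> a; first [exact: slmZ | by apply: slm_sum => b; apply: slmZ].
congr (_ + _ - _); apply: eq_bigr => a _; rewrite ?actAZ //.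
by rewrite actA_sum => [|b]; [apply: eq_bigr => b _; rewrite actAZ | apply: slmZ].
Qed.

End ActTheory.

Section Subspaces.
Variables (R : realType) (V : lmodType R).

Lemma subspaceZ (S : V -> Prop) : subspace S -> forall a u, S u -> S (a *: u).
Proof. by case=> S0 SP a u Su; rewrite -[_ *: _]addr0; apply: SP. Qed.

Lemma subspaceD (S : V -> Prop) : subspace S -> forall u v, S u -> S v -> S (u + v).
Proof. by case=> S0 SP u v Su Sv; rewrite -[u]scale1r; apply: SP. Qed.

Lemma subspaceN (S : V -> Prop) : subspace S -> forall u, S u -> S (- u).
Proof. by move=> SS u Su; rewrite -scaleN1r; apply: subspaceZ. Qed.

Lemma subspaceB (S : V -> Prop) : subspace S -> forall u v, S u -> S v -> S (u - v).
Proof. by move=> SS u v Su Sv; apply: subspaceD => //; apply: subspaceN. Qed.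

Lemma subspace_sum (S : V -> Prop) (J : Type) (r : seq J) (P : pred J) (F : J -> V) :
  subspace S -> (forall k, P k -> S (F k)) -> S (\sum_(k <- r | P k) F k).
Proof.
by move=> SS hF; elim/big_ind: _ => //; [exact: SS.1 | exact: subspaceD].
Qed.

Lemma subspaceI (S T : V -> Prop) : subspace S -> subspace T -> subspace (fun v => S v /\ T v).
Proof.
move=> [S0 SP] [T0 TP]; split=> // a u v [Su Tu] [Sv Tv]; split; [exact: SP|exact: TP].
Qed.

End Subspaces.

Section CyclicSubmod.
Variables (R : realType) (m : nat) (M : amod R m).

(** Taken as the intersection of all submodules through [x], so that a membership proof is itself an
    induction principle. *)
Definition cyclic_sub (x : amV M) : amV M -> Prop :=
  fun v => forall S : amV M -> Prop, submod S -> S x -> S v.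

Lemma cyclic_sub_submod x : submod (cyclic_sub x).
Proof.
split; first split.
- by move=> S hS _; exact: hS.1.1.
- by move=> a u v hu hv S hS Sx; apply: hS.1.2; [exact: hu | exact: hv].
- by move=> A hA v hv S hS Sx; apply: hS.2 => //; exact: hv.
Qed.

Lemma cyclic_sub_gen x : cyclic_sub x x.
Proof. by []. Qed.

End CyclicSubmod.

Section SubAmod.
Variables (R : realType) (m : nat) (M : amod R m) (S : amV M -> Prop).

(** The proof of [submod S] is an argument so that the closure instance and the module type built on
    it can be attached to the predicate. *)
Definition sub_pred (_ : submod S) : {pred amV M} := fun x => `[< S x >].

Variable HS : submod S.

Lemma sub_predP x : reflect (S x) (x \in sub_pred HS).
Proof. exact: asboolP. Qed.

Fact sub_pred_closed : submod_closed (sub_pred HS).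
Proof.
split; first by apply/sub_predP; exact: HS.1.1.
by move=> a u v /sub_predP hu /sub_predP hv; apply/sub_predP/HS.1.2.
Qed.

HB.instance Definition _ := GRing.isSubmodClosed.Build R (amV M) (sub_pred HS) sub_pred_closed.

Record sub_car := SubCar { sub_val : amV M; sub_valP : sub_val \in sub_pred HS }.

HB.instance Definition _ := [isSub for sub_val].
HB.instance Definition _ := [Choice of sub_car by <:].
HB.instance Definition _ := [SubChoice_isSubLmodule of sub_car by <:].

Lemma sub_valS (x : sub_car) : S (val x).
Proof. by apply/sub_predP; exact: valP. Qed.

Definition mk_sub x (Sx : S x) : sub_car := SubCar (introT (sub_predP x) Sx).

(** Only traceless matrices are known to preserve [S]; the default 0 makes the operation total for
    the others. *)
Definition sub_act (A : Mat R m) (x : sub_car) : sub_car :=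
  insubd (0 : sub_car) (act M A (val x)).

Lemma val_sub_act A x : slm A -> val (sub_act A x) = act M A (val x).
Proof.
by move=> hA; rewrite /sub_act insubdK //; apply/sub_predP/HS.2 => //; exact: sub_valS.
Qed.

Fact sub_act_linV A : slm A -> forall (a : R) (u v : sub_car),
  sub_act A (a *: u + v) = a *: sub_act A u + sub_act A v.
Proof.
by move=> hA a u v; apply: val_inj; rewrite linearP /= !val_sub_act // linearP act_linV.
Qed.

Fact sub_act_linA A B : slm A -> slm B -> forall (a : R) (v : sub_car),
  sub_act (a *: A + B) v = a *: sub_act A v + sub_act B v.
Proof.
move=> hA hB a v; apply: val_inj; rewrite linearP /= !val_sub_act //; last exact: slmP.
exact: act_linA.
Qed.

Fact sub_act_br A B : slm A -> slm B -> forall v : sub_car,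
  sub_act (A *m B - B *m A) v = sub_act A (sub_act B v) - sub_act B (sub_act A v).
Proof.
move=> hA hB v; apply: val_inj; rewrite linearB /= !val_sub_act //; last exact: slm_comm.
exact: act_br.
Qed.

Definition sub_amod : amod R m := AMod sub_act_linV sub_act_linA sub_act_br.

End SubAmod.

Section Homs.
Variables (R : realType) (m : nat).

Lemma amhom0 (M N : amod R m) (f : amV M -> amV N) : amhom f -> f 0 = 0.
Proof.
case=> hf _; have := hf 1 0 0; rewrite !scale1r addr0 => h.
by apply: (addrI (f 0)); rewrite addr0.
Qed.

Lemma amhomD (M N : amod R m) (f : amV M -> amV N) : amhom f -> {morph f : u v / u + v}.
Proof. by case=> hf _ u v; have := hf 1 u v; rewrite !scale1r. Qed.

Lemma amhomZ (M N : amod R m) (f : amV M -> amV N) : amhom f ->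
  forall a u, f (a *: u) = a *: f u.
Proof. by move=> hf a u; have := hf.1 a u 0; rewrite (amhom0 hf) !addr0. Qed.

Lemma amhomB (M N : amod R m) (f : amV M -> amV N) : amhom f -> {morph f : u v / u - v}.
Proof. by move=> hf u v; rewrite (amhomD hf) -scaleN1r (amhomZ hf) scaleN1r. Qed.

Lemma amhom_sum (M N : amod R m) (f : amV M -> amV N) (J : Type) (r : seq J) (F : J -> amV M) :
  amhom f -> f (\sum_(k <- r) F k) = \sum_(k <- r) f (F k).
Proof. by move=> hf; apply: (big_morph _ (amhomD hf) (amhom0 hf)). Qed.

Lemma Omega_amhom (M N : amod R m) (f : amV M -> amV N) : amhom f ->
  forall v, f (Omega v) = Omega (f v).
Proof.
move=> hf v; have fA A u : slm A -> f (act M A u) = act N A (f u) by move=> hA; rewrite hf.2.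
rewrite /Omega (amhomB hf) (amhomD hf) (amhomZ hf) !(amhom_sum _ _ hf) fA; last exact: slm_E.
rewrite (amhomB hf) (amhomZ hf) fA; last exact: slm_E.
congr (_ + _ - _).
- apply: eq_bigr => a _; rewrite (amhom_sum _ _ hf); apply: eq_bigr => b _.
  by rewrite !fA //; exact: slm_xd.
- congr (_ *: _); apply: eq_bigr => a _; rewrite !fA //; [exact: slm_d|exact: slm_xE].
Qed.

Lemma OmegaP (M : amod R m) (a : R) (u v : amV M) :
  Omega (a *: u + v) = a *: Omega u + Omega v.
Proof.
have sE := slm_E R m; have sxd k l := @slm_xd R m k l.
rewrite /Omega; transitivity
  (\sum_k \sum_l (a *: act M (vf_xd R k l) (act M (vf_xd R l k) u) +
                  act M (vf_xd R k l) (act M (vf_xd R l k) v)) +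
   (a *: act M (vf_E R m) (act M (vf_E R m) u - m.+1%:R *: u) +
    act M (vf_E R m) (act M (vf_E R m) v - m.+1%:R *: v)) -
   2%:R *: \sum_k (a *: act M (vf_xE R k) (act M (vf_d R k) u) +
                   act M (vf_xE R k) (act M (vf_d R k) v))).
  congr (_ + _ - _ *: _).
  - by apply: eq_bigr => k _; apply: eq_bigr => l _; rewrite !act_linV.
  - rewrite -act_linV //; congr (act M _ _); rewrite act_linV // !scalerDr !scalerA.
    rewrite [m.+1%:R * a]mulrC -scalerA opprD addrACA; congr (_ + _).
    by rewrite scalerN scalerA.
  - by apply: eq_bigr => k _; rewrite !act_linV //; [exact: slm_xE|exact: slm_d].
under eq_bigr do rewrite big_split /= -scaler_sumr.
rewrite !big_split /= -!scaler_sumr.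
rewrite addrACA -scalerDr [2%:R *: (_ + _)]scalerDr [2%:R *: (a *: _)]scalerA [2%:R * a]mulrC.
by rewrite -scalerA opprD addrACA -scalerBr.
Qed.

End Homs.

(** * Highest weight modules *)

Section SumsOfEigenvectors.
Variables (R : realType) (V : lmodType R) (T : V -> V).
Hypothesis TP : forall (a : R) u v, T (a *: u + v) = a *: T u + T v.

Let T0 : T 0 = 0.
Proof.
by have := TP 1 0 0; rewrite !scale1r addr0 => h; apply: (addrI (T 0)); rewrite addr0.
Qed.

Let Rop (ds : seq R) u := foldr (fun d u => T u - d *: u) u ds.

Let RopP ds a u v : Rop ds (a *: u + v) = a *: Rop ds u + Rop ds v.
Proof.
elim: ds => //= d ds ->; rewrite TP scalerDr opprD addrACA scalerBr.
by rewrite !scalerA [d * a]mulrC.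
Qed.

Let Rop_eigen ds d u : T u = d *: u -> Rop ds u = (\prod_(e <- ds) (d - e)) *: u.
Proof.
have TZ a w : T (a *: w) = a *: T w by have := TP a w 0; rewrite T0 !addr0.
move=> hu; elim: ds => [|e ds IH]; first by rewrite big_nil scale1r.
by rewrite /= IH TZ hu big_cons !scalerA -scalerBl; congr (_ *: _); ring.
Qed.

(** The product of the T - d over the nonzero eigenvalues d kills T y, where y is the sum, since T y
    has no component of eigenvalue 0. But T (T y) = 0, so this product acts on T y as the nonzero
    scalar given by the product of the -d. *)
Lemma eigen_sum_ker n (c : 'I_n -> R) (w : 'I_n -> V) :
  (forall t, T (w t) = c t *: w t) ->
  T (T (\sum_t w t)) = 0 -> T (\sum_t w t) = 0.
Proof.
move=> hw h2; set y := \sum_t w t in h2 *.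
pose ds := [seq d <- [seq c t | t <- enum 'I_n] | d != 0].
have hT u v : T (u + v) = T u + T v by have := TP 1 u v; rewrite !scale1r.
have hR u v : Rop ds (u + v) = Rop ds u + Rop ds v by have := RopP ds 1 u v; rewrite !scale1r.
have R0 : Rop ds 0 = 0.
  by have := hR 0 0; rewrite addr0 => h; apply: (addrI (Rop ds 0)); rewrite addr0.
have Ty : T y = \sum_t c t *: w t.
  by rewrite /y (big_morph _ hT T0); apply: eq_bigr => t _; rewrite hw.
have : Rop ds (T y) = 0.
  rewrite Ty (big_morph _ hR R0) big1 // => t _.
  have -> : Rop ds (c t *: w t) = c t *: Rop ds (w t).
    by have := RopP ds (c t) (w t) 0; rewrite R0 !addr0.
  rewrite (Rop_eigen _ (hw t)) scalerA.
  have [->|ct0] := eqVneq (c t) 0; first by rewrite mul0r scale0r.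
  have ct : c t \in ds by rewrite mem_filter ct0 map_f // mem_enum.
  by rewrite (big_rem _ ct) /= subrr mul0r mulr0 scale0r.
rewrite (@Rop_eigen ds 0 (T y)) ?scale0r // => /eqP; rewrite scaler_eq0 => /orP[|/eqP //].
rewrite prodf_seq_eq0 => /hasP[d]; rewrite mem_filter => /andP[d0 _] /=.
by rewrite sub0r oppr_eq0 (negbTE d0).
Qed.

End SumsOfEigenvectors.

(** * Commutation relations of the root vectors *)

Section Brackets.
Variables (R : realType) (m : nat).

Lemma vf_xdE (a b : 'I_m) :
  vf_xd R a b = Eij R (lift ord0 a) (lift ord0 b) - ((a == b)%:R / m.+1%:R)%:M.
Proof.
rewrite /vf_xd; congr (_ - _); case: eqP => _ /=; first by rewrite mul1r.
by rewrite mul0r raddf0.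
Qed.

Lemma br_shift (A B : Mat R m) (x y : R) :
  (A - x%:M) *m (B - y%:M) - (B - y%:M) *m (A - x%:M) = A *m B - B *m A.
Proof.
rewrite !mulmxBl !mulmxBr !(mul_scalar_mx, mul_mx_scalar) !scale_scalar_mx.
rewrite [y * x]mulrC !opprB; set AB := A *m B; set BA := B *m A.
set xB := x *: B; set yA := y *: A; set z := _%:M.
by apply/matrixP => i j; rewrite !mxE; ring.
Qed.

Lemma EijM (a b c d : 'I_m.+1) : Eij R a b *m Eij R c d = (b == c)%:R *: Eij R a d.
Proof. by rewrite /Eij mul_delta_mx_cond scaler_nat. Qed.

Lemma br_xd (a b c d : 'I_m) :
  vf_xd R a b *m vf_xd R c d - vf_xd R c d *m vf_xd R a b =
  (b == c)%:R *: vf_xd R a d - (d == a)%:R *: vf_xd R c b.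
Proof.
rewrite !vf_xdE br_shift !EijM !(inj_eq lift_inj) !scalerBr !scale_scalar_mx.
have -> : (d == a)%:R * ((c == b)%:R / m.+1%:R) = (b == c)%:R * ((a == d)%:R / m.+1%:R) :> R.
  by rewrite [c == b]eq_sym [a == d]eq_sym; ring.
by rewrite opprB addrA subrK.
Qed.

Lemma br_xd_xE (a b c : 'I_m) :
  vf_xd R a b *m vf_xE R c - vf_xE R c *m vf_xd R a b = (b == c)%:R *: vf_xE R a.
Proof.
have -> : vf_xE R c = - Eij R (lift ord0 c) 0 - 0%:M.
  by rewrite (_ : 0%:M = 0) ?subr0 //; exact: raddf0.
rewrite vf_xdE br_shift mulmxN mulNmx opprK !EijM (inj_eq lift_inj).
by rewrite (_ : (0 == lift ord0 a) = false) // scale0r addr0 /vf_xE scalerN.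
Qed.

End Brackets.

Lemma act_scaleB (R : realType) (m : nat) (M : amod R m) (a b : R) (A B : Mat R m) (u : amV M) :
  slm A -> slm B -> a *: act M A u - b *: act M B u = act M (a *: A - b *: B) u.
Proof.
move=> hA hB; rewrite -[in RHS](scaleNr b) actAD; [|exact: slmZ|exact: slmZ].
by rewrite !actAZ // scaleNr.
Qed.

Section HighestWeight.
Variables (R : realType) (m : nat) (M : amod R m).
Implicit Types (u v z : amV M) (lam : weight R m).

Definition hw_vector lam z :=
  [/\ forall a, act M (vf_xd R a a) z = lam (lift ord0 a) *: z,
      forall b, act M (vf_d R b) z = 0 &
      forall a b : 'I_m, (a < b)%N -> act M (vf_xd R a b) z = 0].

Definition neg_closed (S : amV M -> Prop) :=
  (forall a u, S u -> S (act M (vf_xE R a) u)) /\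
  (forall a b : 'I_m, (b < a)%N -> forall u, S u -> S (act M (vf_xd R a b) u)).

(** This is U(n^-) z, where n^- is spanned by the negative root vectors; the induction principle
    stands in for a basis of Poincaré-Birkhoff-Witt type. *)
Definition neg_span z u := forall S, subspace S -> neg_closed S -> S z -> S u.

Lemma neg_span_subspace z : subspace (neg_span z).
Proof.
split; first by move=> S [].
by move=> a u v hu hv S hS nS Sz; apply: hS.2; [exact: hu | exact: hv].
Qed.

Lemma neg_span_closed z : neg_closed (neg_span z).
Proof.
split; first by move=> a u hu S hS nS Sz; apply: nS.1; exact: hu.
by move=> a b ab u hu S hS nS Sz; apply: nS.2 => //; exact: hu.
Qed.

(** The property Q that every A u stays in the span passes from u to f u, for a negative root vector
    f, by A f u = f A u + [A, f] u; quantifying over all A inside Q covers the bracket. On z itself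
    the triangular decomposition applies. *)
Lemma neg_span_submod lam z : hw_vector lam z -> submod (neg_span z).
Proof.
move=> [hz dz nz]; have sS := neg_span_subspace z; have [cE cx] := neg_span_closed z.
have zz : neg_span z z by [].
split=> // A hA u hu.
pose Q u := neg_span z u /\ forall A, slm A -> neg_span z (act M A u).
suff : Q u by case=> _; apply.
apply: hu; rewrite /Q.
- split; first by split=> [|B hB]; rewrite ?act0 //; exact: sS.1.
  move=> a v w [hv gv] [hw gw]; split; first exact: sS.2.
  by move=> B hB; rewrite act_linV //; apply: sS.2; [exact: gv|exact: gw].
- have key f w : slm f -> (forall w, neg_span z w -> neg_span z (act M f w)) ->
      Q w -> Q (act M f w).
    move=> hf fc [hw gw]; split; first exact: fc.
    move=> B hB; have -> : act M B (act M f w) =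
        act M f (act M B w) + act M (B *m f - f *m B) w.
      by rewrite act_br // addrCA subrr addr0.
    by apply: (subspaceD sS); [exact: fc (gw _ hB) | exact: gw (slm_comm _ _)].
  by split=> [a w|a b ab w]; apply: key => //; [exact: slm_xE|exact: cE|exact: slm_xd|exact: cx].
- split=> // B hB; rewrite act_decomp //.
  apply: (subspaceB sS); first apply: (subspaceD sS).
  + apply: (subspace_sum _ sS) => a _; apply: (subspace_sum _ sS) => b _; apply: (subspaceZ sS).
    have [ab|ba|/val_inj <-] := ltngtP a b; last by rewrite hz; apply: (subspaceZ sS).
      by rewrite nz //; exact: sS.1.
    exact: cx.
  + by apply: (subspace_sum _ sS) => b _; apply: (subspaceZ sS); rewrite dz; exact: sS.1.
  + by apply: (subspace_sum _ sS) => a _; apply: (subspaceZ sS); apply: cE.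
Qed.

(* A grading element for which every negative root vector has negative integral
   degree, so that the weight of a highest weight vector is isolated. *)
Definition grad u : amV M := - \sum_(a < m) (a.+1)%:R *: act M (vf_xd R a a) u.

Lemma gradP a u v : grad (a *: u + v) = a *: grad u + grad v.
Proof.
rewrite /grad scalerN scaler_sumr -opprD -big_split; congr (- _); apply: eq_bigr => k _ /=.
by rewrite act_linV ?scalerDr ?scalerA ?[a * _]mulrC //; exact: slm_xd.
Qed.

Lemma grad_xE a u :
  grad (act M (vf_xE R a) u) = act M (vf_xE R a) (grad u) - (a.+1)%:R *: act M (vf_xE R a) u.
Proof.
have sE := slm_xE R a; have sx b := slm_xd R b b.
rewrite /grad actN // act_sum // -opprD; congr (- _).
have e k : act M (vf_xd R k k) (act M (vf_xE R a) u) =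
    act M (vf_xE R a) (act M (vf_xd R k k) u) + (k == a)%:R *: act M (vf_xE R k) u.
  by rewrite -(actAZ _ _ (slm_xE R k)) -br_xd_xE act_br // addrCA subrr addr0.
under eq_bigr do rewrite e scalerDr -actZ //.
rewrite big_split /=; congr (_ + _).
rewrite (bigD1 a) //= eqxx scale1r big1 ?addr0 // => k ka.
by rewrite (negbTE ka) scale0r scaler0.
Qed.

Lemma grad_xd (a b : 'I_m) u : (b < a)%N ->
  grad (act M (vf_xd R a b) u) =
  act M (vf_xd R a b) (grad u) - (a - b)%:R *: act M (vf_xd R a b) u.
Proof.
move=> ba; have sx := slm_xd R.
rewrite /grad actN // act_sum // -opprD; congr (- _).
have e k : act M (vf_xd R k k) (act M (vf_xd R a b) u) =
    act M (vf_xd R a b) (act M (vf_xd R k k) u) +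
    ((k == a)%:R *: act M (vf_xd R k b) u - (b == k)%:R *: act M (vf_xd R a k) u).
  have -> : (k == a)%:R *: act M (vf_xd R k b) u - (b == k)%:R *: act M (vf_xd R a k) u =
      act M ((k == a)%:R *: vf_xd R k b - (b == k)%:R *: vf_xd R a k) u.
    exact: act_scaleB.
  by rewrite -br_xd act_br // addrCA subrr addr0.
under eq_bigr do rewrite e scalerDr -actZ //.
rewrite big_split /=; congr (_ + _).
under eq_bigr do rewrite scalerBr.
rewrite big_split /= sumrN.
rewrite (bigD1 a) //= eqxx scale1r big1 ?addr0 => [|k ka]; last first.
  by rewrite (negbTE ka) scale0r scaler0.
rewrite (bigD1 b) //= eqxx scale1r big1 ?addr0 => [|k ka]; last first.
  by rewrite eq_sym (negbTE ka) scale0r scaler0.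
rewrite -scalerBl -natrB; last by rewrite ltnS ltnW.
by rewrite subSS.
Qed.

Variables (h0 : R).

Definition low_span u := forall S : amV M -> Prop, subspace S ->
  (forall k w, (0 < k)%N -> grad w = (h0 - k%:R) *: w -> S w) -> S u.

Lemma low_span_subspace : subspace low_span.
Proof.
split; first by move=> S [].
by move=> a u v hu hv S hS eS; apply: hS.2; [exact: hu | exact: hv].
Qed.

Lemma low_span_eigen k w : (0 < k)%N -> grad w = (h0 - k%:R) *: w -> low_span w.
Proof. by move=> k0 hw S hS; apply; [exact: k0|]. Qed.

Lemma low_span_closed : neg_closed low_span.
Proof.
have key f t : slm f -> (forall w, grad (act M f w) = act M f (grad w) - t%:R *: act M f w) ->
    forall u, low_span u -> low_span (act M f u).
  move=> hf ht u hu; apply: (hu (fun u => low_span (act M f u))).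
    split; first by rewrite act0 //; exact: low_span_subspace.1.
    by move=> a v w hv hw; rewrite act_linV //; apply: low_span_subspace.2.
  move=> k w k0 hw; apply: (@low_span_eigen (k + t)%N); first by rewrite addn_gt0 k0.
  by rewrite ht hw actZ // -scalerBl natrD opprD addrA.
split=> [a|a b ba]; first exact: key (slm_xE R a) (grad_xE a).
exact: key (slm_xd R a b) (fun u => grad_xd u ba).
Qed.

(** The product of the operators [grad - (h0 - k)] for 1 <= k <= n. *)
Fixpoint low_killer n u := if n is n'.+1 then
  let w := low_killer n' u in grad w - (h0 - n%:R) *: w else u.

Lemma low_killerP n a u v :
  low_killer n (a *: u + v) = a *: low_killer n u + low_killer n v.
Proof.
elim: n => //= n ->; rewrite gradP scalerDr opprD addrACA scalerBr.
by rewrite !scalerA [a * _]mulrC.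
Qed.

Lemma grad0 : grad 0 = 0.
Proof.
have := gradP 1 0 0; rewrite !scale1r addr0 => h.
by apply: (addrI (grad 0)); rewrite addr0.
Qed.

Lemma low_killer_eigen n c u : grad u = c *: u ->
  low_killer n u = (\prod_(k < n) (c - (h0 - k.+1%:R))) *: u.
Proof.
have gZ a w : grad (a *: w) = a *: grad w by have := gradP a w 0; rewrite grad0 !addr0.
move=> hu; elim: n => [|n IH]; first by rewrite big_ord0 scale1r.
by rewrite [LHS]/= IH gZ hu big_ord_recr /= !scalerA -scalerBl; congr (_ *: _); ring.
Qed.

Lemma low_span_killed u : low_span u -> exists n, low_killer n u = 0.
Proof.
have kS n n' v : (n <= n')%N -> low_killer n v = 0 -> low_killer n' v = 0.
  move=> /subnK <-; elim: (n' - n)%N => // k IH h /=.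
  by rewrite IH // grad0 scaler0 subr0.
move=> hu; apply: (hu (fun u => exists n, low_killer n u = 0)).
- split; first by exists 0%N.
  move=> a v w [n hv] [n' hw]; exists (maxn n n').
  rewrite low_killerP (kS n) ?leq_maxl // (kS n' _ w) ?leq_maxr //.
  by rewrite scaler0 addr0.
- move=> [//|k] w _ hw; exists k.+1.
  by rewrite (low_killer_eigen _ hw) big_ord_recr /= subrr mulr0 scale0r.
Qed.

(** Some [low_killer n] kills u, whereas on the eigenvalue [h0] it is multiplication by n!. *)
Lemma low_span_top u : low_span u -> grad u = h0 *: u -> u = 0.
Proof.
move=> /low_span_killed[n]; move=> hn hu; move: hn.
rewrite (low_killer_eigen _ hu) => /eqP; rewrite scaler_eq0 => /orP[|/eqP //].
rewrite prodf_seq_eq0 => /hasP[k _] /=.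
by rewrite opprB addrCA subrr addr0 pnatr_eq0.
Qed.

End HighestWeight.

(** The module generated by z is the line of z plus [low_span], because each negative root vector
    strictly lowers the degree [grad]. If u = r z + l accordingly, then l has the degree of z and
    lies in [low_span], hence vanishes. *)
Lemma hw_space_line (R : realType) (m : nat) (M : amod R m) (lam : weight R m) (z u : amV M) :
  hw_vector lam z -> cyclic_sub z u ->
  (forall a, act M (vf_xd R a a) u = lam (lift ord0 a) *: u) ->
  exists r : R, u = r *: z.
Proof.
move=> hz hu wu; pose h0 : R := - \sum_(a < m) a.+1%:R * lam (lift ord0 a).
have gw v : (forall a, act M (vf_xd R a a) v = lam (lift ord0 a) *: v) -> grad v = h0 *: v.
  move=> wv; rewrite /grad /h0 scaleNr scaler_suml; congr (- _).
  by apply: eq_bigr => a _; rewrite wv scalerA.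
have gz : grad z = h0 *: z by apply: gw; case: hz.
have nz : neg_span z u.
  by apply: hu; [exact: (neg_span_submod hz) | by []].
have lS := low_span_subspace M h0; have lc := low_span_closed M h0.
have [r hr] : exists r : R, low_span h0 (u - r *: z).
  apply: (nz (fun u => exists r : R, low_span h0 (u - r *: z))).
  - split; first by exists 0; rewrite scale0r subr0; exact: lS.1.
    move=> a v w [r hv] [r' hw]; exists (a * r + r').
    have -> : a *: v + w - (a * r + r') *: z = a *: (v - r *: z) + (w - r' *: z).
      by rewrite scalerBr scalerA scalerDl opprD addrACA.
    exact: lS.2.
  - have key f t v : slm f -> (0 < t)%N ->
        (forall w, grad (act M f w) = act M f (grad w) - t%:R *: act M f w) ->
        (forall w, low_span h0 w -> low_span h0 (act M f w)) ->
        (exists r : R, low_span h0 (v - r *: z)) ->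
        exists r : R, low_span h0 (act M f v - r *: z).
      (* A lowering operator sends both v - r z and z into [low_span], so no multiple of z
         survives. *)
      move=> hf t0 ht fc [r hr]; exists 0; rewrite scale0r subr0.
      rewrite -[v](subrK (r *: z)) actD // actZ //.
      apply: (subspaceD lS); first exact: fc.
      apply: (subspaceZ lS); apply: (low_span_eigen t0).
      by rewrite ht gz actZ // -scalerBl.
    split=> [a v|a b ba v].
      by apply: (key _ a.+1) => //; [exact: slm_xE|exact: grad_xE|exact: lc.1].
    apply: (key _ (a - b)%N) => //; [exact: slm_xd|by rewrite subn_gt0| |exact: lc.2].
    by move=> w; apply: grad_xd.
  - by exists 1; rewrite scale1r subrr; exact: lS.1.
exists r; apply/eqP; rewrite -subr_eq0; apply/eqP/(low_span_top hr).
rewrite -scaleNr addrC gradP gz [grad u]gw // scalerDr !scalerA.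
by rewrite [h0 * _]mulrC.
Qed.

(** * Complete reducibility from a contravariant form *)

Section FiniteSpans.
Variables (R : realType) (V : lmodType R).

Fixpoint lspan (t : seq V) : V -> Prop :=
  if t is x :: t' then fun v => exists c : R, lspan t' (v - c *: x) else fun v => v = 0.

Lemma lspan_subspace t : subspace (lspan t).
Proof.
elim: t => [|x t IH]; split => /=; rewrite ?scaler0 ?addr0 //.
- by move=> a u v -> ->; rewrite scaler0 addr0.
- by exists 0; rewrite scale0r subr0; exact: IH.1.
- move=> a u v [c hu] [d hv]; exists (a * c + d).
  have -> : a *: u + v - (a * c + d) *: x = a *: (u - c *: x) + (v - d *: x).
    by rewrite scalerBr scalerA scalerDl opprD addrACA.
  exact: IH.2.
Qed.

Lemma lspan_consr x t v : lspan t v -> lspan (x :: t) v.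
Proof. by move=> h; exists 0; rewrite scale0r subr0. Qed.

Lemma lspan_mem t x : x \in t -> lspan t x.
Proof.
elim: t => // y t IH; rewrite inE => /orP[/eqP ->|/IH]; last exact: lspan_consr.
by exists 1; rewrite scale1r subrr; exact: (lspan_subspace t).1.
Qed.

Lemma lspan_sub (S : V -> Prop) t : subspace S -> (forall x, x \in t -> S x) ->
  forall v, lspan t v -> S v.
Proof.
move=> hS; elim: t => [|x t IH] ht v /=; first by move=> ->; exact: hS.1.
case=> c hv; rewrite -[v](subrK (c *: x)); apply: (subspaceD hS).
  by apply: IH => // y yt; apply: ht; rewrite inE yt orbT.
by apply: (subspaceZ hS); apply: ht; rewrite inE eqxx.
Qed.

Definition lcomb (t : seq V) (c : 'rV[R]_(size t)) : V := \sum_(k < size t) c 0 k *: t`_k.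

Lemma lcombP t a (c d : 'rV_(size t)) : lcomb (a *: c + d) = a *: lcomb c + lcomb d.
Proof.
rewrite /lcomb scaler_sumr -big_split; apply: eq_bigr => k _ /=.
by rewrite !mxE scalerDl scalerA.
Qed.

Lemma lcomb0 t : lcomb (0 : 'rV_(size t)) = 0.
Proof. by rewrite /lcomb big1 // => k _; rewrite mxE scale0r. Qed.

Lemma lspan_lcomb t v : lspan t v -> exists c : 'rV_(size t), v = lcomb c.
Proof.
apply: (lspan_sub (S := fun v => exists c : 'rV_(size t), v = lcomb c)); last first.
  move=> x xt; have kt : (index x t < size t)%N by rewrite index_mem.
  exists (delta_mx 0 (Ordinal kt)); rewrite /lcomb (bigD1 (Ordinal kt)) //= big1 => [|k kt'].
    by rewrite mxE !eqxx scale1r addr0 nth_index.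
  by rewrite mxE eqxx /= (negbTE kt') scale0r.
split.
  by exists 0; rewrite lcomb0.
by move=> a u v' [c ->] [d ->]; exists (a *: c + d); rewrite lcombP.
Qed.

(** A vector space inside S of maximal dimension exhausts S: adjoining one more vector of S cannot
    raise its dimension. *)
Lemma subspace_vspace (vT : vectType R) (S : vT -> Prop) : subspace S ->
  exists U : {vspace vT}, forall v, S v <-> v \in U.
Proof.
move=> hS; pose P n := `[< exists U : {vspace vT}, (forall v, v \in U -> S v) /\ \dim U = n >].
have P0 : exists n, P n.
  exists 0%N; apply/asboolP; exists 0%VS; split; last exact: dimv0.
  by move=> v; rewrite memv0 => /eqP ->; exact: hS.1.
have Pb n : P n -> (n <= \dim {:vT})%N.
  by move=> /asboolP[U [_ <-]]; apply: dimvS; exact: subvf.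
case: (ex_maxnP P0 Pb) => n /asboolP[U [US dU]] nmax.
exists U => v; split; last exact: US.
move=> Sv; have UV : (U <= U + <[v]>)%VS by exact: addvSl.
have : (\dim (U + <[v]>)%VS <= \dim U)%N.
  rewrite dU; apply: nmax; apply/asboolP; exists (U + <[v]>)%VS; split => //.
  move=> w /memv_addP[x xU [y /vlineP[c ->] ->]]; apply: (subspaceD hS); first exact: US.
  exact: (subspaceZ hS).
move=> dle; have /eqP -> : (U == U + <[v]>)%VS by rewrite eqEdim UV.
by apply: (subvP (addvSr _ _)); rewrite memv_line.
Qed.

Section Pullback.
Variables (t : seq V) (S : V -> Prop).
Hypotheses (hS : subspace S) (St : forall v, S v -> lspan t v).

(** The list [t] may be linearly dependent, so S is replaced by the space of all coefficient vectors
    whose combination lies in S. *)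
Lemma pullback_vspace : exists U : {vspace 'rV[R]_(size t)}, forall c, S (lcomb c) <-> c \in U.
Proof.
apply: subspace_vspace; split.
  by rewrite lcomb0; exact: hS.1.
by move=> a c d hc hd; rewrite lcombP; apply: hS.2.
Qed.

Lemma fin_dim_lspan : exists t', (forall x, x \in t' -> S x) /\ forall v, S v -> lspan t' v.
Proof.
have [U hU] := pullback_vspace.
exists [seq lcomb c | c <- vbasis U]; split.
  by move=> x /mapP[c /vbasis_mem cU ->]; apply/hU.
move=> v Sv; have [c cv] := lspan_lcomb (St Sv).
have cU : c \in U by apply/hU; rewrite -cv.
rewrite cv (coord_vbasis cU).
have hD : {morph @lcomb t : c d / c + d}.
  by move=> c1 c2; have := lcombP 1 c1 c2; rewrite !scale1r.
have sL := lspan_subspace [seq lcomb c | c <- vbasis U].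
rewrite (big_morph _ hD (lcomb0 t)); apply: (subspace_sum _ sL) => k _.
rewrite -[_ *: _]addr0 lcombP lcomb0 addr0; apply: (subspaceZ sL); apply: lspan_mem.
by apply: map_f; rewrite mem_nth // size_tuple.
Qed.

End Pullback.

Lemma fin_dim_sub t (S : V -> Prop) : subspace S -> (forall v, S v -> lspan t v) -> fin_dim S.
Proof.
move=> hS St; have [t' [t'S St']] := fin_dim_lspan hS St.
exists t'; split=> // w /St' /lspan_lcomb[c ->].
by exists (fun k => c 0 k).
Qed.

(** Well-founded induction on strict inclusion, measured by the dimension of the space of
    coefficient vectors. *)
Lemma subspace_ind t (P : (V -> Prop) -> Prop) :
  (forall A, subspace A -> (forall v, A v -> lspan t v) ->
    (forall B, subspace B -> (forall v, B v -> A v) -> (exists2 v, A v & ~ B v) -> P B) -> P A) ->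
  forall A, subspace A -> (forall v, A v -> lspan t v) -> P A.
Proof.
move=> step A hA At; have [U hU] := pullback_vspace t hA.
have [n] := ubnP (\dim U); elim: n A hA At U hU => // n IH A hA At U hU dU.
apply: step => // B hB BA [v Av nBv].
have [W hW] := pullback_vspace t hB.
apply: (IH B hB _ W hW); first by move=> w /BA /At.
have WU : (W <= U)%VS by apply/subvP => c /hW /BA /hU.
apply: leq_trans (dU : (\dim U <= n)%N); rewrite ltn_neqAle dimvS // andbT.
apply/eqP => dWU; have /eqP WUe : (W == U)%VS by rewrite eqEdim WU dWU leqnn.
have [c cv] := lspan_lcomb (At _ Av).
by apply: nBv; rewrite cv; apply/hW; rewrite WUe; apply/hU; rewrite -cv.
Qed.

End FiniteSpans.

(** * Orthogonal projection for an anisotropic symmetric form *)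

Section OrthogonalProjection.
Variables (R : realType) (V : lmodType R) (B : V -> V -> R).
Hypothesis BP : forall a u v w, B (a *: u + v) w = a * B u w + B v w.
Hypothesis BC : forall u v, B u v = B v u.
Hypothesis B_aniso : forall v, B v v = 0 -> v = 0.

Lemma bform0l w : B 0 w = 0.
Proof. by have := BP (-1) 0 0 w; rewrite scaler0 addr0 mulN1r addNr. Qed.

Lemma bformDl u v w : B (u + v) w = B u w + B v w.
Proof. by have := BP 1 u v w; rewrite scale1r mul1r. Qed.

Lemma bformZl a u w : B (a *: u) w = a * B u w.
Proof. by have := BP a u 0 w; rewrite bform0l !addr0. Qed.

Lemma bformBl u v w : B (u - v) w = B u w - B v w.
Proof. by rewrite bformDl -scaleN1r bformZl mulN1r. Qed.

Lemma bform_suml (J : Type) (r : seq J) (F : J -> V) w :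
  B (\sum_(k <- r) F k) w = \sum_(k <- r) B (F k) w.
Proof. by apply: (big_morph (B^~ w)) => [u v|]; rewrite ?bformDl ?bform0l. Qed.

Lemma orth_subspace (S : V -> Prop) : subspace (fun v => forall w, S w -> B v w = 0).
Proof.
split; first by move=> w _; rewrite bform0l.
by move=> a u v hu hv w Sw; rewrite BP hu // hv // mulr0 addr0.
Qed.

Lemma gram_schmidt_step (e y z : V) (d : R) : B y y != 0 -> B e z = 0 -> B y z = 0 ->
  B (d *: y + z) (e - (B e y / B y y) *: y) = 0.
Proof.
move=> yy ez yz; rewrite BP [B z _]BC !bformBl !bformZl ez yz [B y (_ - _)]BC bformBl bformZl.
by rewrite divfK // subrr; ring.
Qed.

(** Gram-Schmidt on a list that may be dependent: y is x minus its projection to the span of the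
    tail. If y is isotropic it is zero and x adds nothing; otherwise the projection is corrected
    along y. *)
Lemma lspan_proj t v : exists2 p, lspan t p & forall w, lspan t w -> B (v - p) w = 0.
Proof.
elim: t v => [|x t IH] v.
  by exists 0 => // w ->; rewrite BC bform0l.
have [p hp op] := IH v; have [q hq oq] := IH x.
pose y := x - q.
have ty w : lspan t w -> B y w = 0 by exact: oq.
have txy : lspan (x :: t) y.
  by exists 1; rewrite scale1r /y addrC addrA addNr sub0r; apply: (subspaceN (lspan_subspace t)).
have [y0|y0] := eqVneq (B y y) 0.
  exists p; first exact: lspan_consr.
  move=> w [c hw]; apply: op; rewrite -[w](subrK (c *: x)).
  apply: (subspaceD (lspan_subspace t)) => //; apply: (subspaceZ (lspan_subspace t)).
  by have /eqP := B_aniso y0; rewrite subr_eq0 => /eqP ->.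
pose c := B (v - p) y / B y y.
exists (p + c *: y).
  apply: (subspaceD (lspan_subspace (x :: t))); first exact: lspan_consr.
  exact: (subspaceZ (lspan_subspace (x :: t))).
move=> w [d hw].
set z := w - d *: x + d *: q.
have tz : lspan t z by apply: (subspaceD (lspan_subspace t)) => //; apply: (subspaceZ (lspan_subspace t)).
have -> : w = d *: y + z by rewrite /z /y scalerBr addrC -addrA [X in _ + X]addrC !subrK.
have eD : v - (p + c *: y) = (v - p) - c *: y by rewrite opprD addrA.
have ez : B (v - p) z = 0 by exact: op.
by rewrite eD BC gram_schmidt_step // ty.
Qed.

End OrthogonalProjection.

Section ContravariantForm.
Variables (R : realType) (m : nat) (M : amod R m) (B : amV M -> amV M -> R).
Hypothesis BP : forall a u v w, B (a *: u + v) w = a * B u w + B v w.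
Hypothesis BC : forall u v, B u v = B v u.
Hypothesis B_aniso : forall v, B v v = 0 -> v = 0.
Hypothesis B_adj : forall a b u v, B (act M (vf_xd R a b) u) v = B u (act M (vf_xd R b a) v).

Let V := amV M.
Let nz (A : V -> Prop) := ~ (forall x, A x -> x = 0).

(** If A is not irreducible it contains a smaller nonzero invariant subspace, and finite dimension
    stops the descent. *)
Lemma lsubmod_irr t (A : V -> Prop) : lsubmod A -> (forall v, A v -> lspan t v) -> nz A ->
  exists T : V -> Prop, l_irred T /\ forall v, T v -> A v.
Proof.
move=> lA At; have sA := lA.1; move: A sA At lA.
apply: subspace_ind => A sA At IH lA nA.
have [hirr|nirr] := pselect (l_irred A); first by exists A.
have : ~ forall U : V -> Prop, lsubmod U -> (forall x, U x -> A x) ->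
    (forall x, U x -> x = 0) \/ (forall x, A x -> U x).
  move=> h; apply: nirr; split=> //; split=> //.
  move: nA => /existsNP[x /not_implyP[Ax x0]]; exists x; split=> //.
  exact/eqP.
move=> /existsNP[U /not_implyP[lU /not_implyP[UA /not_orP[nU nAU]]]].
move: nAU => /existsNP[v /not_implyP[Av nUv]].
have [|T [iT TU]] := IH U lU.1 UA _ lU nU; first by exists v.
by exists T; split=> // w /TU /UA.
Qed.

Definition orth_to (T : V -> Prop) := fun v : V => forall w, T w -> B v w = 0.

Lemma orth_to_lsubmod T : lsubmod T -> lsubmod (orth_to T).
Proof.
move=> [sT lT]; split; first exact: orth_subspace.
by move=> a b v hv w Tw; rewrite B_adj hv //; apply: lT.
Qed.

Lemma lsubmodI (S T : V -> Prop) : lsubmod S -> lsubmod T -> lsubmod (fun v => S v /\ T v).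
Proof.
move=> [sS lS] [sT lT]; split; first exact: subspaceI.
by move=> a b v [Sv Tv]; split; [apply: lS|apply: lT].
Qed.

Lemma subspace_proj t (S : V -> Prop) : subspace S -> (forall v, S v -> lspan t v) ->
  forall v, exists2 p, S p & orth_to S (v - p).
Proof.
move=> sS St v; have [t' [t'S St']] := fin_dim_lspan sS St.
have [p hp op] := lspan_proj BP BC B_aniso t' v.
by exists p => [|w /St' /op]; [apply: (lspan_sub sS t'S)|].
Qed.

(** Split off an irreducible T and continue in its orthogonal complement, which is invariant because
    the form is contravariant. *)
Lemma lsubmod_decomp t (A : V -> Prop) : lsubmod A -> (forall v, A v -> lspan t v) ->
  exists (n : nat) (T : nat -> V -> Prop),
  [/\ forall k, (k < n)%N -> l_irred (T k) /\ (forall v, T k v -> A v),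
      forall k l, (k < n)%N -> (l < n)%N -> k != l -> forall v, T k v -> orth_to (T l) v &
      forall v, A v -> exists w : nat -> V,
        (forall k, (k < n)%N -> T k (w k)) /\ v = \sum_(k < n) w k].
Proof.
move=> lA At; have sA := lA.1; move: A sA At lA.
apply: subspace_ind => A sA At IH lA.
have [A0|nA] := pselect (forall x, A x -> x = 0).
  exists 0%N, (fun _ _ => False); split=> // v /A0 ->.
  by exists (fun _ => 0); rewrite big_ord0.
have [T [iT TA]] := lsubmod_irr lA At nA.
have lT : lsubmod T := iT.1.
pose A' v := A v /\ orth_to T v.
have lA' : lsubmod A' by apply: lsubmodI => //; exact: orth_to_lsubmod.
(* The complement is strictly smaller: a nonzero vector of T is not orthogonal to itself. *)
have [||n [Ts [hT oT dT]]] := IH A' lA'.1 _ _ lA'; first by move=> v [].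
  have [x [Tx /eqP x0]] := iT.2.1; exists x; first exact: TA.
  by move=> [_ /(_ x Tx) /B_aniso].
exists n.+1, (fun k => if k is k'.+1 then Ts k' else T); split.
- move=> [|k] //= kn; have [iTk TkA] := hT k kn.
  by split=> // v /TkA[].
- move=> [|k] [|l] //= kn ln kl v hv w hw; last exact: (oT k l).
    by rewrite BC; apply: ((hT l ln).2 _ hw).2.
  by apply: ((hT k kn).2 _ hv).2.
- move=> v Av; have [p Tp op] := subspace_proj lT.1 (fun v Tv => At _ (TA v Tv)) v.
  have [|w [hw vw]] := dT (v - p).
    by split=> //; apply: (subspaceB sA) => //; exact: TA.
  exists (fun k => if k is k'.+1 then w k' else p); split; first by case.
  by rewrite big_ord_recl /= -vw addrC subrK.
Qed.

Variable Fil : nat -> V -> Prop.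
Hypothesis Fil_lsub : forall d, lsubmod (Fil d).
Hypothesis Fil_fin : forall d, exists t, forall v, Fil d v -> lspan t v.
Hypothesis Fil_le : forall d d' v, (d <= d')%N -> Fil d v -> Fil d' v.
Hypothesis Fil_exh : forall v, exists d, Fil d v.

(** The layers [A d], the complements of [Fil d.-1] in [Fil d] (with [A 0] equal to [Fil 0]), are
    finite-dimensional and mutually orthogonal. Decomposing each one gives a family of pairwise
    orthogonal irreducibles, and orthogonality makes the sum direct. *)
Lemma form_l_fd_semisimple : l_fd_semisimple M.
Proof.
pose A d v := Fil d v /\ (if d is d'.+1 then orth_to (Fil d') v else True).
have lA d : lsubmod (A d).
  apply: lsubmodI => //; case: d => [|d]; last exact: orth_to_lsubmod.
  by split=> //; split.
have [t Ft] : exists t, forall d v, Fil d v -> lspan (t d) v.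
  by exists (fun d => projT1 (cid (Fil_fin d))) => d; case: cid.
have At d v : A d v -> lspan (t d) v by case=> /Ft.
have [n [T hT]] : exists (n : nat -> nat) (T : nat -> nat -> V -> Prop), forall d,
  [/\ forall k, (k < n d)%N -> l_irred (T d k) /\ (forall v, T d k v -> A d v),
      forall k l, (k < n d)%N -> (l < n d)%N -> k != l -> forall v, T d k v -> orth_to (T d l) v &
      forall v, A d v -> exists w : nat -> V,
        (forall k, (k < n d)%N -> T d k (w k)) /\ v = \sum_(k < n d) w k].
  have hd d := cid (lsubmod_decomp (lA d) (At d)).
  exists (fun d => projT1 (hd d)), (fun d => projT1 (cid (projT2 (hd d)))) => d.
  by case: cid.
have hF d k : (k < n d)%N -> forall v, T d k v -> Fil d v.
  by move=> kn v; have [h _ _] := hT d => Tv; have [_ TA] := h k kn; case: (TA v Tv).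
have oT d k d' k' : (k < n d)%N -> (k' < n d')%N -> (d, k) != (d', k') ->
    forall v w, T d k v -> T d' k' w -> B v w = 0.
  have lt d1 k1 d2 k2 : (k1 < n d1)%N -> (k2 < n d2)%N -> (d1 < d2)%N ->
      forall v w, T d1 k1 v -> T d2 k2 w -> B v w = 0.
    move=> kn1 kn2 d12 v w hv hw; case: d2 d12 kn2 hw => // d2 d12 kn2 hw.
    have [h _ _] := hT d2.+1; have [_ TA] := h k2 kn2; have [_] := TA w hw.
    by rewrite BC; apply; apply: Fil_le (hF _ _ kn1 _ hv).
  move=> kn kn' ne v w hv hw; have [dd|dd|dd] := ltngtP d d'.
  - exact: lt dd v w hv hw.
  - by rewrite BC; exact: lt dd w v hw hv.
  - subst d'; have [_ h _] := hT d; apply: (h k k') => //.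
    by move: ne; rewrite xpair_eqE eqxx.
pose K := {dk : nat * nat | (dk.2 < n dk.1)%N}.
exists K, (fun k : K => T (sval k).1 (sval k).2); split; [|split].
- move=> [[d k] kn] /=; have [h _ _] := hT d; have [iT TA] := h k kn; split=> //.
  by apply: (@fin_dim_sub _ _ (t d) _ iT.1.1) => v /TA /At.
- move=> v; have [d Fv] := Fil_exh v.
  (* Projecting v to [Fil d] for decreasing d leaves one remainder in each layer. *)
  have [w [hw vw]] : exists w : nat -> nat -> V,
      (forall e k, (k < n e)%N -> T e k (w e k)) /\
      v = \sum_(e < d.+1) \sum_(k < n e) w e k.
    elim: d v Fv => [|d IH] v Fv.
      have [_ _ h] := hT 0%N; have [|w [hw vw]] := h v; first by [].
      exists (fun e k => if e is 0%N then w k else 0); split; last by rewrite big_ord1.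
      move=> [|e] k kn; first exact: hw.
      have [h' _ _] := hT e.+1; exact: (h' k kn).1.1.1.1.
    have [p Fp op] := subspace_proj (Fil_lsub d).1 (Ft d) v.
    have [w [hw pw]] := IH p Fp.
    have [_ _ h] := hT d.+1; have [|w' [hw' vw]] := h (v - p).
      by split=> //; apply: (subspaceB (Fil_lsub d.+1).1) => //; exact: Fil_le Fp.
    exists (fun e k => if e == d.+1 then w' k else w e k); split.
      by move=> e k; case: eqP => [->|_]; [exact: hw'|exact: hw].
    rewrite big_ord_recr /= eqxx -vw.
    under eq_bigr => e _ do rewrite (ltn_eqF (ltn_ord e)).
    by rewrite -pw addrC subrK.
  (* The double sum is flattened, since a decomposition is indexed by a single ordinal type with
     distinct labels. *)
  pose s := [seq (e, k) | e <- iota 0 d.+1, k <- iota 0 (n e)].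
  have us : uniq s.
    apply: allpairs_uniq_dep; [exact: iota_uniq|by move=> e _; exact: iota_uniq|].
    by move=> [e k] [e' k'] _ _ [-> ->].
  have sP dk : dk \in s -> (dk.2 < n dk.1)%N.
    by move=> /allpairsPdep[e [k [_ hk ->]]]; move: hk; rewrite mem_iota.
  have sn (i : 'I_(size s)) : ((nth (0, 0)%N s i).2 < n (nth (0, 0)%N s i).1)%N.
    by apply: sP; rewrite mem_nth.
  exists (size s), (fun i : 'I_(size s) => exist _ (nth (0, 0)%N s i) (sn i)).
  exists (fun i : 'I_(size s) => w (nth (0, 0)%N s i).1 (nth (0, 0)%N s i).2); split; [|split].
  + move=> i j [] /eqP; rewrite nth_uniq // => /eqP ij; exact: val_inj.
  + by move=> i /=; apply: hw.
  + rewrite vw -(big_mkord xpredT (fun e => \sum_(k < n e) w e k)) /index_iota subn0.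
    rewrite -(big_mkord xpredT (fun i => w (nth (0, 0)%N s i).1 (nth (0, 0)%N s i).2)).
    rewrite -(big_nth (0, 0)%N xpredT (fun dk => w dk.1 dk.2)) big_allpairs_dep /=.
    by apply: eq_bigr => e _; rewrite -(big_mkord xpredT (fun k => w e k)) /index_iota subn0.
(* Pairing the vanishing sum with [w k0] leaves only the square of [w k0]. *)
- move=> N ks w ksi hw sw k0.
  apply: B_aniso; have : B (\sum_k w k) (w k0) = 0 by rewrite sw (bform0l BP).
  rewrite (bform_suml BP) (bigD1 k0) //= big1 ?addr0 // => k kk0.
  apply: (oT _ _ _ _ (valP (ks k)) (valP (ks k0)) _ _ _ (hw k) (hw k0)).
  apply: contra kk0 => /eqP h; apply/eqP/ksi/val_inj => /=.
  by rewrite [LHS]surjective_pairing [RHS]surjective_pairing.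
Qed.

End ContravariantForm.

(** * The polynomial model *)

Section FirstOrderOperators.
Variables (R : comNzRingType) (I : finType).

Notation P := {mpoly R[#|{: I}|]}.

Definition var (v : I) : P := 'X_(enum_rank v).
Definition pd (v : I) (p : P) : P := p^`M(enum_rank v).
Definition vder (F : I -> P) (p : P) : P := \sum_v F v * pd v p.

Lemma pd_comm u v p : pd u (pd v p) = pd v (pd u p).
Proof. exact: mderiv_comm. Qed.

Lemma pdM v p q : pd v (p * q) = pd v p * q + p * pd v q.
Proof. exact: mderivM. Qed.

Lemma pdD v p q : pd v (p + q) = pd v p + pd v q.
Proof. exact: mderivD. Qed.

Lemma pdZ v a p : pd v (a *: p) = a *: pd v p.
Proof. exact: mderivZ. Qed.

Lemma pd_sum v (J : Type) (r : seq J) (G : J -> P) : pd v (\sum_(j <- r) G j) = \sum_(j <- r) pd v (G j).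
Proof. by apply: (big_morph (pd v)); [exact: pdD|exact: mderiv0]. Qed.

Lemma pd_var u v : pd u (var v) = (u == v)%:R.
Proof.
rewrite /pd /var mderivX mnm1E eq_sym (inj_eq enum_rank_inj).
case: eqP => [->|_]; last by rewrite scale0r.
rewrite scale1r -mpolyX0; congr ('X_[_]); apply/mnmP => k.
by rewrite mnmBE mnm0E subnn.
Qed.

Lemma vderP F a p q : vder F (a *: p + q) = a *: vder F p + vder F q.
Proof.
rewrite /vder scaler_sumr -big_split; apply: eq_bigr => v _ /=.
by rewrite pdD pdZ mulrDr scalerAr.
Qed.

Lemma vderD F p q : vder F (p + q) = vder F p + vder F q.
Proof. by have := vderP F 1 p q; rewrite !scale1r. Qed.

Lemma vder0 F : vder F 0 = 0.
Proof. by apply: (addrI (vder F 0)); rewrite -vderD !addr0. Qed.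

Lemma vderZ F a p : vder F (a *: p) = a *: vder F p.
Proof. by have := vderP F a p 0; rewrite vder0 !addr0. Qed.

Lemma vderN F p : vder F (- p) = - vder F p.
Proof. by rewrite -scaleN1r vderZ scaleN1r. Qed.

Lemma vderB F p q : vder F (p - q) = vder F p - vder F q.
Proof. by rewrite vderD vderN. Qed.

Lemma vder_sum F (J : Type) (r : seq J) (G : J -> P) :
  vder F (\sum_(j <- r) G j) = \sum_(j <- r) vder F (G j).
Proof. by apply: (big_morph _ (vderD F) (vder0 F)). Qed.

Lemma vderM F p q : vder F (p * q) = vder F p * q + p * vder F q.
Proof.
rewrite /vder mulr_suml mulr_sumr -big_split; apply: eq_bigr => v _ /=.
by rewrite pdM; ring.
Qed.

Lemma vder_var F v : vder F (var v) = F v.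
Proof.
rewrite /vder (bigD1 v) //= pd_var eqxx mulr1 big1 ?addr0 // => u uv.
by rewrite pd_var (negbTE uv) mulr0.
Qed.

Lemma vderC F (a : R) : vder F a%:MP = 0.
Proof. by rewrite /vder big1 // => v _; rewrite /pd mderivC mulr0. Qed.

Lemma vder1 F : vder F 1 = 0.
Proof. by rewrite -mpolyC1 vderC. Qed.

Lemma eq_vder F G : F =1 G -> vder F =1 vder G.
Proof. by move=> FG p; apply: eq_bigr => v _; rewrite FG. Qed.

(** The second order terms are symmetric because partial derivatives commute, so they cancel. *)
Lemma vder_comm F G p :
  vder F (vder G p) - vder G (vder F p) = vder (fun v => vder F (G v) - vder G (F v)) p.
Proof.
have e F1 G1 : vder F1 (vder G1 p) =
    \sum_v vder F1 (G1 v) * pd v p + \sum_v \sum_u G1 v * F1 u * pd u (pd v p).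
  rewrite {2}/vder vder_sum -big_split; apply: eq_bigr => v _ /=.
  rewrite vderM; congr (_ + _); rewrite {1}/vder mulr_sumr.
  by apply: eq_bigr => u _; rewrite mulrA.
rewrite !e [X in _ - (_ + X)]exchange_big /=.
have -> : \sum_v \sum_u F u * G v * pd v (pd u p) = \sum_v \sum_u G v * F u * pd u (pd v p).
  by apply: eq_bigr => v _; apply: eq_bigr => u _; rewrite pd_comm [F u * _]mulrC.
rewrite opprD addrACA subrr addr0 /vder -sumrB.
by apply: eq_bigr => v _; rewrite mulrBl.
Qed.

End FirstOrderOperators.

(** * Tensor fields on projective space in an affine chart *)

Section Model.
Variables (R : realType) (m : nat) (c : R).

Definition cidx := (('I_m + 'I_m) + ('I_m * 'I_m))%type.
Notation P := {mpoly R[#|{: cidx}|]}.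

(* The variables are the coordinates [x_a], the variables [xi_a] on which
   [x_a E_x] acts through [d/dxi_a], and the entries [y_ak] of [m] vectors whose
   polarisations carry the gl_m-modules of highest weight a partition. *)
Definition ix (a : 'I_m) : cidx := inl (inl a).
Definition ixi (a : 'I_m) : cidx := inl (inr a).
Definition iy (a k : 'I_m) : cidx := inr (a, k).
Definition px a : P := var R (ix a).
Definition pxi a : P := var R (ixi a).
Definition py a k : P := var R (iy a k).

Definition ext (z0 : P) (z : 'I_m -> P) (k : 'I_m.+1) : P :=
  if unlift ord0 k is Some a then z a else z0.

Lemma ext0 z0 z : ext z0 z ord0 = z0.
Proof. by rewrite /ext unlift_none. Qed.

Lemma extS z0 z a : ext z0 z (lift ord0 a) = z a.
Proof. by rewrite /ext liftK. Qed.

Definition hX := ext 1 px.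
Definition hXi := ext (1 - \sum_a px a * pxi a) pxi.
Definition hY k := ext 0 (py^~ k).

Lemma hX0 : hX ord0 = 1. Proof. exact: ext0. Qed.
Lemma hXS a : hX (lift ord0 a) = px a. Proof. exact: extS. Qed.
Lemma hXi0 : hXi ord0 = 1 - \sum_a px a * pxi a. Proof. exact: ext0. Qed.
Lemma hXiS a : hXi (lift ord0 a) = pxi a. Proof. exact: extS. Qed.
Lemma hY0 k : hY k ord0 = 0. Proof. exact: ext0. Qed.
Lemma hYS k a : hY k (lift ord0 a) = py a k. Proof. exact: extS. Qed.

(** The elementary matrix with entry 1 at (l, k) stands for the linear field X_l d/dX_k, so matrices
    act on points as on row vectors, through [vm], and on covectors as on columns, through [mv]. *)
Definition vm (A : Mat R m) (Z : 'I_m.+1 -> P) k := \sum_l A l k *: Z l.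
Definition mv (A : Mat R m) (Z : 'I_m.+1 -> P) k := \sum_l A k l *: Z l.

(* The projective action of a matrix [A] on the homogeneous coordinates
   [hX = (1, x)], prolonged to the tangent directions [hY] and the cotangent
   directions [hXi]; [mult] twists it by a density, so that the identity matrix
   acts by zero. *)
Definition coef (A : Mat R m) (v : cidx) : P :=
  match v with
  | inl (inl a) => vm A hX (lift ord0 a) - vm A hX 0 * px a
  | inl (inr a) => vm A hX 0 * pxi a - mv A hXi (lift ord0 a)
  | inr (a, k) => vm A (hY k) (lift ord0 a) - vm A (hY k) 0 * px a - vm A hX 0 * py a k
  end.

Definition mult (A : Mat R m) : P := (c * \tr A)%:MP - (c * m.+1%:R) *: vm A hX 0.

Definition mact (A : Mat R m) (p : P) : P := vder (coef A) p + mult A * p.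

Lemma vmP a A B Z k : vm (a *: A + B) Z k = a *: vm A Z k + vm B Z k.
Proof.
rewrite /vm scaler_sumr -big_split; apply: eq_bigr => l _ /=.
by rewrite !mxE scalerDl scalerA.
Qed.

Lemma mvP a A B Z k : mv (a *: A + B) Z k = a *: mv A Z k + mv B Z k.
Proof.
rewrite /mv scaler_sumr -big_split; apply: eq_bigr => l _ /=.
by rewrite !mxE scalerDl scalerA.
Qed.

Lemma vmM A B Z k : vm (A *m B) Z k = vm B (vm A Z) k.
Proof.
rewrite /vm; under [RHS]eq_bigr do rewrite scaler_sumr.
rewrite exchange_big; apply: eq_bigr => l _ /=; rewrite mxE scaler_suml.
by apply: eq_bigr => q _; rewrite scalerA mulrC.
Qed.

Lemma mvM A B Z k : mv (A *m B) Z k = mv A (mv B Z) k.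
Proof.
rewrite /mv; under [RHS]eq_bigr do rewrite scaler_sumr.
rewrite exchange_big; apply: eq_bigr => l _ /=; rewrite mxE scaler_suml.
by apply: eq_bigr => q _; rewrite scalerA.
Qed.

Lemma vmB A B Z k : vm (A - B) Z k = vm A Z k - vm B Z k.
Proof. by rewrite addrC -scaleN1r vmP scaleN1r addrC. Qed.

Lemma mvB A B Z k : mv (A - B) Z k = mv A Z k - mv B Z k.
Proof. by rewrite addrC -scaleN1r mvP scaleN1r addrC. Qed.

Lemma coefP a A B v : coef (a *: A + B) v = a *: coef A v + coef B v.
Proof.
case: v => [[b|b]|[b k]] /=; rewrite !vmP ?mvP -!mul_mpolyC; ring.
Qed.

Lemma multP a A B : mult (a *: A + B) = a *: mult A + mult B.
Proof.
rewrite /mult vmP linearP /= -!mul_mpolyC !mpolyCM mpolyCD !mpolyCM; ring.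
Qed.

Lemma vder_vm F A Z k : vder F (vm A Z k) = vm A (fun l => vder F (Z l)) k.
Proof. by rewrite /vm vder_sum; apply: eq_bigr => l _; rewrite vderZ. Qed.

Lemma vder_mv F A Z k : vder F (mv A Z k) = mv A (fun l => vder F (Z l)) k.
Proof. by rewrite /mv vder_sum; apply: eq_bigr => l _; rewrite vderZ. Qed.

Lemma vder_hX A k : vder (coef A) (hX k) = vm A hX k - vm A hX 0 * hX k.
Proof.
case: (unliftP ord0 k) => [a|] ->; first by rewrite hXS vder_var.
by rewrite hX0 vder1 mulr1 subrr.
Qed.

Lemma vder_hY A j k : vder (coef A) (hY j k) =
  vm A (hY j) k - vm A (hY j) 0 * hX k - vm A hX 0 * hY j k.
Proof.
case: (unliftP ord0 k) => [a|] ->; first by rewrite hYS hXS vder_var.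
by rewrite hY0 hX0 vder0 mulr1 mulr0 !subrr.
Qed.
Lemma vm_mv A Z W : \sum_k vm A Z k * W k = \sum_k Z k * mv A W k.
Proof.
rewrite /vm /mv; under eq_bigr do rewrite mulr_suml.
rewrite exchange_big; apply: eq_bigr => k _ /=; rewrite mulr_sumr.
by apply: eq_bigr => l _; rewrite -scalerAl scalerAr.
Qed.

(* The extended covector [hXi] satisfies [hX . hXi = 1], so its derivative is
   forced by that of [hX]. *)
Lemma vder_hXi A k : vder (coef A) (hXi k) = vm A hX 0 * hXi k - mv A hXi k.
Proof.
case: (unliftP ord0 k) => [a|] ->; first by rewrite hXiS vder_var.
rewrite hXi0 vderB vder1 sub0r vder_sum.
under eq_bigr do rewrite vderM !vder_var /= mulrBl mulrBr.
rewrite big_split /= !sumrB.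
have := vm_mv A hX hXi; rewrite !big_ord_recl hXi0 hX0.
under [X in _ + X = _]eq_bigr do rewrite hXiS.
under [X in _ = _ + X]eq_bigr do rewrite hXS.
set S1 := \sum_k vm _ _ _ * _; set S2 := \sum_k px _ * mv _ _ _ => h.
have -> : \sum_a px a * (vm A hX 0 * pxi a) = vm A hX 0 * \sum_a px a * pxi a.
  by rewrite mulr_sumr; apply: eq_bigr => a _; ring.
have -> : \sum_a vm A hX 0 * px a * pxi a = vm A hX 0 * \sum_a px a * pxi a.
  by rewrite mulr_sumr; apply: eq_bigr => a _; ring.
have -> : S2 = vm A hX 0 * (1 - \sum_a px a * pxi a) + S1 - mv A hXi 0 by rewrite h; ring.
by ring.
Qed.

Lemma vm_lin a Z W A k : vm A (fun l => Z l - a * W l) k = vm A Z k - a * vm A W k.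
Proof.
rewrite /vm mulr_sumr -sumrB; apply: eq_bigr => l _.
by rewrite scalerBr scalerAr.
Qed.

Lemma vder_vm_hX A B k : vder (coef A) (vm B hX k) = vm (A *m B) hX k - vm A hX 0 * vm B hX k.
Proof.
rewrite vder_vm vmM -vm_lin; apply: eq_bigr => l _; congr (_ *: _); exact: vder_hX.
Qed.

Lemma vder_vm_hY A B j k : vder (coef A) (vm B (hY j) k) =
  vm (A *m B) (hY j) k - vm A (hY j) 0 * vm B hX k - vm A hX 0 * vm B (hY j) k.
Proof.
rewrite vder_vm vmM -!vm_lin; apply: eq_bigr => l _; congr (_ *: _); exact: vder_hY.
Qed.

Lemma vder_mv_hXi A B k : vder (coef A) (mv B hXi k) =
  vm A hX 0 * mv B hXi k - mv (B *m A) hXi k.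
Proof.
rewrite vder_mv mvM /mv mulr_sumr -sumrB; apply: eq_bigr => l _.
by rewrite -scalerAr -scalerBr; congr (_ *: _); rewrite vder_hXi.
Qed.

Lemma coef_br A B v :
  vder (coef A) (coef B v) - vder (coef B) (coef A v) = coef (A *m B - B *m A) v.
Proof.
case: v => [[a|a]|[a k]] /=; rewrite !(vderB, vderM, vder_vm_hX, vder_vm_hY, vder_mv_hXi).
- by rewrite !vder_var /= !vmB; ring.
- by rewrite !vder_var /= !vmB !mvB; ring.
- by rewrite !vder_var /= !vmB; ring.
Qed.

(** Two facts combine: the fields with coefficients [coef] close under the bracket, and [mult] is a
    cocycle for them. Both hold for all matrices, traceless or not. *)
Lemma mact_br A B p : mact (A *m B - B *m A) p = mact A (mact B p) - mact B (mact A p).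
Proof.
rewrite /mact !vderD !vderM.
have -> : vder (coef (A *m B - B *m A)) p =
    vder (coef A) (vder (coef B) p) - vder (coef B) (vder (coef A) p).
  by rewrite vder_comm; apply: eq_vder => v; rewrite coef_br.
have -> : mult (A *m B - B *m A) = vder (coef A) (mult B) - vder (coef B) (mult A).
  rewrite /mult !vderB !vderC !vderZ !vder_vm_hX linearB /= mxtrace_mulC subrr mulr0 mpolyC0.
  by rewrite vmB -!mul_mpolyC; ring.
by ring.
Qed.

Fact mact_linV A : slm A -> forall (a : R) (u v : P), mact A (a *: u + v) = a *: mact A u + mact A v.
Proof. by move=> _ a u v; rewrite /mact vderP -!mul_mpolyC; ring. Qed.

Fact mact_linA A B : slm A -> slm B -> forall (a : R) (v : P),
  mact (a *: A + B) v = a *: mact A v + mact B v.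
Proof.
move=> _ _ a v; rewrite /mact multP.
have -> : vder (coef (a *: A + B)) v = a *: vder (coef A) v + vder (coef B) v.
  rewrite /vder scaler_sumr -big_split; apply: eq_bigr => u _ /=.
  by rewrite coefP mulrDl scalerAl.
by rewrite -!mul_mpolyC; ring.
Qed.

Fact mact_br_sl A B : slm A -> slm B -> forall v : P,
  mact (A *m B - B *m A) v = mact A (mact B v) - mact B (mact A v).
Proof. by move=> _ _ v; exact: mact_br. Qed.

Definition model : amod R m := AMod mact_linV mact_linA mact_br_sl.

Lemma vm_Eij a b Z k : vm (Eij R a b) Z k = (k == b)%:R *: Z a.
Proof.
rewrite /vm (bigD1 a) //= mxE eqxx big1 ?addr0 // => l la.
by rewrite mxE (negbTE la) scale0r.
Qed.

Lemma mv_Eij a b Z k : mv (Eij R a b) Z k = (k == a)%:R *: Z b.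
Proof.
rewrite /mv (bigD1 b) //= mxE eqxx andbT big1 ?addr0 // => l lb.
by rewrite mxE (negbTE lb) andbF scale0r.
Qed.

Lemma vm_scalar t Z k : vm t%:M Z k = t *: Z k.
Proof.
rewrite /vm (bigD1 k) //= mxE eqxx mulr1n big1 ?addr0 // => l lk.
by rewrite mxE (negbTE lk) scale0r.
Qed.

Lemma mv_scalar t Z k : mv t%:M Z k = t *: Z k.
Proof.
rewrite /mv (bigD1 k) //= mxE eqxx mulr1n big1 ?addr0 // => l lk.
by rewrite mxE eq_sym (negbTE lk) scale0r.
Qed.

Lemma coef_scalar t v : coef t%:M v = 0.
Proof.
case: v => [[a|a]|[a k]] /=; rewrite ?mv_scalar !vm_scalar ?(hX0, hXS, hXi0, hXiS, hY0, hYS).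
- by rewrite -!mul_mpolyC; ring.
- by rewrite -!mul_mpolyC; ring.
- by rewrite -!mul_mpolyC; ring.
Qed.

Lemma mult_scalar t : mult t%:M = 0.
Proof.
rewrite /mult vm_scalar hX0 mxtrace_scalar -mulr_natr -mul_mpolyC -mul_mpolyC !mpolyCM; ring.
Qed.

(** Allows the trace correction inside [vf_xd] to be dropped. *)
Lemma coef_shift A t v : coef (A - t%:M) v = coef A v.
Proof. by rewrite addrC -scaleN1r coefP coef_scalar scaler0 add0r. Qed.

Lemma mult_shift A t : mult (A - t%:M) = mult A.
Proof. by rewrite addrC -scaleN1r multP mult_scalar scaler0 add0r. Qed.

End Model.

(** * The Fischer inner product and the degree filtration *)

Section FischerForm.
Variables (R : realType) (n : nat).
Notation P := {mpoly R[n]}.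
Implicit Types (p q : P).

Definition mfact (al : 'X_{1..n}) : R := \prod_(k < n) ((al k)`!)%:R.

Lemma mfact_gt0 al : 0 < mfact al.
Proof. by apply: prodr_gt0 => k _; rewrite ltr0n fact_gt0. Qed.

Lemma mfactU j al : mfact (U_(j) + al) = (al j).+1%:R * mfact al.
Proof.
rewrite /mfact (bigD1 j) //= [in RHS](bigD1 j) //= mulrA -natrM -factS.
congr (_ * _); first by rewrite mnmDE mnm1E eqxx.
by apply: eq_bigr => k kj; rewrite mnmDE mnm1E eq_sym (negbTE kj).
Qed.

(** Monomials are orthogonal, the square norm of the monomial of exponent [al] being the product of
    the factorials of its entries. *)
Definition fischer p q : R := \sum_(al <- msupp p) mfact al * p@_al * q@_al.

Lemma fischer_widen s p q : uniq s -> {subset msupp p <= s} ->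
  fischer p q = \sum_(al <- s) mfact al * p@_al * q@_al.
Proof.
move=> us ps; rewrite /fischer [in RHS](bigID (mem (msupp p))) /=.
rewrite [X in _ = _ + X]big1 ?addr0 => [|al alp]; last first.
  by rewrite (memN_msupp_eq0 alp) mulr0 mul0r.
rewrite -[in RHS]big_filter; apply: perm_big; apply: uniq_perm; rewrite ?msupp_uniq ?filter_uniq //.
move=> al; rewrite mem_filter /=; case: (boolP (al \in msupp p)) => //= /ps ->.
by [].
Qed.

Lemma fischerC p q : fischer p q = fischer q p.
Proof.
pose s := undup (msupp p ++ msupp q).
rewrite (@fischer_widen s p) ?(@fischer_widen s q) ?undup_uniq //.
- by apply: eq_bigr => al _; ring.
- by move=> al h; rewrite mem_undup mem_cat h orbT.
- by move=> al h; rewrite mem_undup mem_cat h.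
Qed.

Lemma fischerP a p q w : fischer (a *: p + q) w = a * fischer p w + fischer q w.
Proof.
rewrite !(fischerC _ w) /fischer mulr_sumr -big_split; apply: eq_bigr => al _ /=.
by rewrite mcoeffD mcoeffZ; ring.
Qed.

Lemma fischer_aniso p : fischer p p = 0 -> p = 0.
Proof.
have nn al : 0 <= mfact al * p@_al * p@_al.
  by rewrite -mulrA mulr_ge0 ?(ltW (mfact_gt0 _)) // -expr2 sqr_ge0.
move=> /eqP; rewrite /fischer psumr_eq0 // => /allP h.
apply/mpolyP => al; rewrite mcoeff0; case: (boolP (al \in msupp p)) => [alp|/memN_msupp_eq0 //].
have := h _ alp; rewrite /= !mulf_eq0 (gt_eqF (mfact_gt0 _)) /=.
by rewrite orbb => /eqP.
Qed.

(** When the exponent grows by one in position j, the norm gains the factor [(al j).+1], which is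
    the one that differentiation produces. *)
Lemma fischer_adj j p q : fischer ('X_j * p) q = fischer p q^`M(j).
Proof.
rewrite {1}/fischer mulrC (perm_big _ (msuppMX p U_(j))) big_map; apply: eq_bigr => al _ /=.
by rewrite mcoeffMX mfactU mcoeff_mderiv addmC -mulr_natr; ring.
Qed.

(** The bound is strict, so that bound 0 means the zero polynomial and iterated derivatives reach
    it. *)
Definition deg_lt d p := forall al, (d <= mdeg al)%N -> p@_al = 0.

Lemma deg_lt_subspace d : subspace (deg_lt d).
Proof.
split; first by move=> al _; rewrite mcoeff0.
by move=> a p q hp hq al dal; rewrite mcoeffD mcoeffZ hp // hq // mulr0 addr0.
Qed.

Lemma deg_lt_deriv d j p : deg_lt d p -> deg_lt d.-1 p^`M(j).
Proof.
move=> hp al dal; rewrite mcoeff_mderiv hp ?mul0rn // mdegD mdeg1 addn1.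
by case: d dal {hp}.
Qed.

Lemma deg_lt_mulX d j p : deg_lt d p -> deg_lt d.+1 ('X_j * p).
Proof.
move=> hp al dal; apply/eqP; rewrite mcoeff_eq0 mulrC (perm_mem (msuppMX p U_(j))).
apply/mapP => -[be bep e]; move: bep; rewrite mcoeff_msupp hp ?eqxx //.
by move: dal; rewrite e mdegD mdeg1.
Qed.

Lemma deg_lt0 p : deg_lt 0 p -> p = 0.
Proof. by move=> h; apply/mpolyP => al; rewrite mcoeff0 h. Qed.

Lemma deg_lt_le d d' p : (d <= d')%N -> deg_lt d p -> deg_lt d' p.
Proof. by move=> dd hp al h; apply: hp; apply: leq_trans h. Qed.

Lemma deg_lt_mulX_deriv d j k p : deg_lt d p -> deg_lt d ('X_j * p^`M(k)).
Proof.
case: d => [|d] hp; last exact/deg_lt_mulX/(@deg_lt_deriv d.+1).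
by rewrite (deg_lt0 hp) raddf0 mulr0; exact: (deg_lt_subspace 0).1.
Qed.

Lemma deg_lt_exists p : exists d, deg_lt d p.
Proof. by exists (msize p) => al /msize_mdeg_ge /memN_msupp_eq0. Qed.

Lemma deg_lt_lspan d : exists t : seq P, forall p, deg_lt d p -> lspan t p.
Proof.
exists [seq 'X_[bmnm al] | al <- enum [set: 'X_{1..n < d}]] => p hp.
set t := map _ _.
have sp : (msize p <= d)%N.
  rewrite msizeE; apply/bigmax_leqP_seq => al alp _; rewrite ltnNge; apply/negP => /hp h.
  by move: alp; rewrite mcoeff_msupp h eqxx.
rewrite (mpolywE sp); have sL := lspan_subspace t.
apply: (subspace_sum _ sL) => al _; apply: (subspaceZ sL); apply: lspan_mem.
by apply: map_f; rewrite mem_enum inE.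
Qed.

End FischerForm.

(** * The action of gl_m on the model, and submodules of the model as objects of O *)

Section ModelOperators.
Variables (R : realType) (m : nat) (c : R).
Notation P := {mpoly R[#|{: cidx m}|]}.
Notation L a b := (mact c (vf_xd R a b)).

Lemma vderE (F : cidx m -> P) (p : P) : vder F p = \sum_a F (ix a) * pd (ix a) p + \sum_a F (ixi a) * pd (ixi a) p
  + \sum_a \sum_(k < m) F (iy a k) * pd (iy a k) p.
Proof.
rewrite /vder big_sumType /= big_sumType /=; congr (_ + _ + _).
by rewrite pair_big; apply: eq_bigr => -[a k].
Qed.

Definition lcoef (a b : 'I_m) : cidx m -> P := coef (Eij R (lift ord0 a) (lift ord0 b)).

Lemma lcoef_x a b e : lcoef a b (ix e) = (e == b)%:R * px R a.
Proof.
rewrite /lcoef /= !vm_Eij (inj_eq lift_inj) hXS scale0r mul0r subr0.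
by rewrite scaler_nat mulr_natl.
Qed.

Lemma lcoef_xi a b e : lcoef a b (ixi e) = - ((e == a)%:R * pxi R b).
Proof.
rewrite /lcoef /= !vm_Eij mv_Eij (inj_eq lift_inj) hXiS scale0r mul0r sub0r.
by rewrite scaler_nat mulr_natl.
Qed.

Lemma lcoef_y a b e k : lcoef a b (iy e k) = (e == b)%:R * py R a k.
Proof.
rewrite /lcoef /= !vm_Eij (inj_eq lift_inj) hYS !scale0r !mul0r !subr0.
by rewrite scaler_nat mulr_natl.
Qed.

Lemma mact_xd_vder (a b : 'I_m) (p : P) : L a b p = vder (lcoef a b) p + (c * (a == b)%:R) *: p.
Proof.
rewrite /mact vf_xdE mult_shift; congr (_ + _); first by apply: eq_vder => v; rewrite coef_shift.
rewrite /mult vm_Eij scale0r scaler0 subr0 mul_mpolyC; congr ((_ * _) *: _).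
rewrite /mxtrace (bigD1 (lift ord0 a)) //= !mxE eqxx (inj_eq lift_inj) big1 ?addr0 // => k ka.
by rewrite !mxE (negbTE ka).
Qed.

Lemma sum_delta (F : 'I_m -> P) b : \sum_e (e == b)%:R * F e = F b.
Proof.
rewrite (bigD1 b) //= eqxx mul1r big1 ?addr0 // => e eb.
by rewrite (negbTE eb) mul0r.
Qed.

Lemma mact_xdE (a b : 'I_m) (p : P) : L a b p =
  px R a * pd (ix b) p - pxi R b * pd (ixi a) p + \sum_(k < m) py R a k * pd (iy b k) p
  + (c * (a == b)%:R) *: p.
Proof.
rewrite mact_xd_vder vderE; congr (_ + _ + _ + _).
- by under eq_bigr do rewrite lcoef_x -mulrA; rewrite sum_delta.
- under eq_bigr do rewrite lcoef_xi mulNr -mulrA.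
  by rewrite sumrN sum_delta.
- under eq_bigr => e _ do under eq_bigr do rewrite lcoef_y -mulrA.
  by under eq_bigr do rewrite -mulr_sumr; rewrite sum_delta.
Qed.

Lemma mact_d (b : 'I_m) (p : P) : mact c (vf_d R b) p = pd (ix b) p.
Proof.
rewrite /mact /mult (slm_d R b : \tr _ = 0) mulr0 mpolyC0 vm_Eij scale0r scaler0 subrr mul0r addr0.
rewrite vderE [X in _ + X + _]big1 => [|e _]; last first.
  by rewrite /= vm_Eij mv_Eij !scale0r mul0r subrr mul0r.
rewrite [X in _ + _ + X]big1 ?addr0 => [|e _]; last first.
  by rewrite big1 // => k _; rewrite /= !vm_Eij hY0 scaler0 !scale0r !mul0r !subr0 mul0r.
rewrite -[RHS](sum_delta (fun e => pd (ix e) p)); apply: eq_bigr => e _; congr (_ * _).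
rewrite /= !vm_Eij (inj_eq lift_inj) hX0 scale0r mul0r subr0.
by rewrite scaler_nat.
Qed.

Lemma fischer_mact_xd (a b : 'I_m) (p q : P) : fischer (L a b p) q = fischer p (L b a q).
Proof.
have fD := bformDl (@fischerP R _); have fZ := bformZl (@fischerP R _).
have fN u w : fischer (- u : P) w = - fischer u w by rewrite -scaleN1r fZ mulN1r.
have adj u v (p1 q1 : P) : fischer (var R u * pd v p1) q1 = fischer p1 (var R v * pd u q1).
  by rewrite fischer_adj fischerC -fischer_adj fischerC.
rewrite !mact_xdE [RHS]fischerC !fD !fN !fZ !(bform_suml (@fischerP R _)).
rewrite [b == a]eq_sym (fischerC q p); congr (_ - _ + _ + _).
- by rewrite adj fischerC.
- by rewrite adj fischerC.
- by apply: eq_bigr => k _; rewrite adj fischerC.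
Qed.

Lemma deg_lt_mact_xd d (a b : 'I_m) (p : P) : deg_lt d p -> deg_lt d (L a b p).
Proof.
move=> hp; have sD := deg_lt_subspace R #|{: cidx m}| d; rewrite mact_xdE.
apply: (subspaceD sD); last exact: (subspaceZ sD).
apply: (subspaceD sD).
  by apply: (subspaceB sD); exact: deg_lt_mulX_deriv.
by apply: (subspace_sum _ sD) => k _; exact: deg_lt_mulX_deriv.
Qed.

Section SubModels.
Variables (S : amV (model m c) -> Prop) (HS : submod S).
Notation N := (sub_amod HS).

(** Anisotropy, contravariance and the degree filtration all restrict to an arbitrary submodule. *)
Lemma sub_l_fd_semisimple : l_fd_semisimple N.
Proof.
have sxd a b := slm_xd R a b.
apply: (@form_l_fd_semisimple R m N (fun u v => fischer (val u : P) (val v))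
  _ _ _ _ (fun d u => deg_lt d (val u : P))).
- by move=> a u v w; rewrite linearP /=; exact: fischerP.
- by move=> u v; exact: fischerC.
- by move=> v /fischer_aniso h; exact: val_inj.
- by move=> a b u v; rewrite !val_sub_act //; exact: fischer_mact_xd.
- move=> d; split; first split.
  + by rewrite linear0; exact: (deg_lt_subspace _ _ d).1.
  + by move=> a u v hu hv; rewrite linearP /=; exact: (deg_lt_subspace _ _ d).2.
  + by move=> a b v hv; rewrite val_sub_act //; exact: deg_lt_mact_xd.
- move=> d; have [t ht] := @deg_lt_lspan R #|{: cidx m}| d.
  (* A spanning list of the polynomials of bounded degree need not lie in S; the intersection with S
     has a list of its own, which lifts to the submodule. *)
  have sI : subspace (fun p : amV (model m c) => S p /\ deg_lt d p).
    by apply: subspaceI; [exact: HS.1|exact: deg_lt_subspace].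
  have [|t' [t'S ht']] := @fin_dim_lspan R _ t _ sI; first by move=> v [_ /ht].
  exists [seq insubd (0 : amV N) p | p <- t'] => v hv.
  have : lspan t' (val v) by apply: ht'; split=> //; exact: sub_valS.
  have {t'S ht'} : forall x, x \in t' -> S x by move=> x /t'S[].
  clear hv; elim: t' v => [|p t' IH] v hS /=; first by move=> v0; exact: val_inj.
  case=> a ha; exists a; apply: IH => [x xt|]; first by apply: hS; rewrite inE xt orbT.
  have Sp : p \in sub_pred HS by apply: (introT (sub_predP HS p)); apply: hS; rewrite inE eqxx.
  by rewrite linearB linearZ /= insubdK ?scalerN //; exact: Sp.
- by move=> d d' v; exact: deg_lt_le.
- by move=> v; exact: deg_lt_exists.
Qed.

Lemma sub_c_locnil : c_locnil N.
Proof.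
move=> v; have [d hd] := deg_lt_exists (val v : P); exists d => s.
have sd b := slm_d R b.
have key (s' : seq 'I_m) :
    deg_lt (d - size s') (val (foldr (fun i x => act N (vf_d R i) x) v s') : P).
  elim: s' => [|i s' IH]; first by rewrite subn0.
  by rewrite /= val_sub_act //= mact_d subnS; exact: deg_lt_deriv.
move=> ss; apply: val_inj; rewrite linear0; apply: deg_lt0.
by have := key s; rewrite ss subnn.
Qed.

End SubModels.

Lemma cyclic_inO (x : amV (model m c)) : inO (sub_amod (cyclic_sub_submod x)).
Proof.
set HS := cyclic_sub_submod x; split; last first.
  by split; [exact: sub_l_fd_semisimple | exact: sub_c_locnil].
exists [:: mk_sub HS (@cyclic_sub_gen _ _ (model m c) x)] => S hS Sx v.
(* [S] lives in the submodule; its image in the model is what membership in [cyclic_sub] can be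
   applied to. *)
pose Q p := exists2 u : amV (sub_amod HS), S u & val u = p.
suff [u Su /val_inj <-] : Q (val v) by [].
apply: (sub_valS v).
- split; first split.
  + by exists 0; [exact: hS.1.1|rewrite linear0].
  + move=> a _ _ [u Su <-] [w Sw <-]; exists (a *: u + w); last by rewrite linearP.
    exact: hS.1.2.
  + move=> A hA _ [u Su <-]; exists (act (sub_amod HS) A u); first exact: hS.2.
    exact: val_sub_act.
- by exists (mk_sub HS (@cyclic_sub_gen _ _ (model m c) x)) => //; apply: Sx; rewrite inE.
Qed.

End ModelOperators.

(** * The Casimir element on the model *)

Section OmegaModel.
Variables (R : realType) (m : nat) (c : R).
Notation P := {mpoly R[#|{: cidx m}|]}.
Notation L a b := (mact c (vf_xd R a b)).

Lemma vm_xE a (Z : 'I_m.+1 -> P) k : vm (vf_xE R a) Z k = - ((k == 0)%:R *: Z (lift ord0 a)).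
Proof.
have -> : vf_xE R a = (-1) *: Eij R (lift ord0 a) 0 + 0 by rewrite addr0 scaleN1r.
by rewrite vmP vm_Eij scaleN1r (_ : vm 0 Z k = 0) ?addr0 // /vm big1 // => l _; rewrite mxE scale0r.
Qed.

Lemma mv_xE a (Z : 'I_m.+1 -> P) k : mv (vf_xE R a) Z k = - ((k == lift ord0 a)%:R *: Z 0).
Proof.
have -> : vf_xE R a = (-1) *: Eij R (lift ord0 a) 0 + 0 by rewrite addr0 scaleN1r.
by rewrite mvP mv_Eij scaleN1r (_ : mv 0 Z k = 0) ?addr0 // /mv big1 // => l _; rewrite mxE scale0r.
Qed.

(** With L_ab = x_a d/dx_b + F_ab, where F_ab acts on the fibre, the Jacobian of x_a E_x gives the
    fibre part sum_b x_b F_ab + x_a sum_b F_bb. Eliminating the F_ab in favour of the L_ab yields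
    the formula; d/dxi_a is the isotropy action on the fibre. *)
Lemma mact_xEE (a : 'I_m) (p : P) :
  mact c (vf_xE R a) p = \sum_b px R b * L a b p +
    px R a * (\sum_b L b b p - \sum_b px R b * pd (ix b) p) + pd (ixi a) p.
Proof.
pose S1 : P := \sum_b px R b * pd (ix b) p.
pose Q : P := \sum_(b < m) px R b * pxi R b.
pose T : P := \sum_b pxi R b * pd (ixi b) p.
pose U : P := \sum_b \sum_k px R b * py R a k * pd (iy b k) p.
pose W : P := \sum_(b < m) \sum_k py R b k * pd (iy b k) p.
have -> : \sum_b px R b * L a b p = px R a * S1 - Q * pd (ixi a) p + U + c *: (px R a * p).
  under eq_bigr do rewrite mact_xdE !mulrDr mulrN.
  rewrite !big_split /= sumrN; congr (_ - _ + _ + _).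
  - by rewrite /S1 mulr_sumr; apply: eq_bigr => b _; ring.
  - by rewrite /Q mulr_suml; apply: eq_bigr => b _; ring.
  - by apply: eq_bigr => b _; rewrite mulr_sumr; apply: eq_bigr => k _; ring.
  - under eq_bigr do rewrite eq_sym -scalerAr -scalerA scaler_nat -mulr_natl.
    by rewrite -scaler_sumr sum_delta.
have -> : \sum_b L b b p = S1 - T + W + (c * m%:R) *: p.
  under eq_bigr do rewrite mact_xdE eqxx mulr1.
  rewrite !big_split /= sumrN sumr_const card_ord; congr (_ + _).
  by rewrite -scaler_nat scalerA mulrC.
rewrite /mact vderE /mult (slm_xE R a : \tr _ = 0) mulr0 mpolyC0 vm_xE eqxx scale1r hXS scalerN opprK add0r.
have -> : \sum_e coef (vf_xE R a) (ix e) * pd (ix e) p = px R a * S1.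
  rewrite /S1 mulr_sumr; apply: eq_bigr => e _.
  by rewrite /= !vm_xE eqxx scale1r scale0r oppr0 hXS; ring.
have -> : \sum_e coef (vf_xE R a) (ixi e) * pd (ixi e) p = - px R a * T + (1 - Q) * pd (ixi a) p.
  rewrite /T mulr_sumr -[in RHS](sum_delta (fun e => (1 - Q) * pd (ixi e) p)) -big_split.
  apply: eq_bigr => e _.
  rewrite /= !vm_xE mv_xE eqxx scale1r hXS (inj_eq lift_inj) hXi0 -/Q scaler_nat -mulr_natl.
  ring.
have -> : \sum_e \sum_k coef (vf_xE R a) (iy e k) * pd (iy e k) p = U + px R a * W.
  rewrite /U /W mulr_sumr -big_split; apply: eq_bigr => e _ /=.
  rewrite mulr_sumr -big_split; apply: eq_bigr => k _ /=.
  by rewrite !vm_xE eqxx !scale1r scale0r oppr0 hXS hYS; ring.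
rewrite -!mul_mpolyC -/S1 !mpolyCM -natr1 mpolyCD; ring.
Qed.

(** Phrased with the derivations alone, without the twist [c], so that such polynomials multiply and
    their weights add. *)
Definition hw_poly (u : P) (wt : 'I_m -> R) :=
  [/\ forall a b : 'I_m, (a < b)%N -> vder (lcoef R a b) u = 0,
      forall a, vder (lcoef R a a) u = wt a *: u &
      forall a, pd (ix a) u = 0].

Lemma hw_poly1 : hw_poly 1 (fun _ => 0).
Proof.
split=> [a b _|a|a]; rewrite ?vder1 ?scale0r //.
by rewrite /pd -mpolyC1 mderivC.
Qed.

Lemma hw_polyM u v wu wv : hw_poly u wu -> hw_poly v wv ->
  hw_poly (u * v) (fun a => wu a + wv a).
Proof.
move=> [ru du xu] [rv dv xv]; split=> [a b ab|a|a].
- by rewrite vderM ru // rv // mul0r mulr0 addr0.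
- by rewrite vderM du dv scalerDl -scalerAl -scalerAr.
- by rewrite pdM xu xv mul0r mulr0 addr0.
Qed.

Lemma hw_poly_eq u wu wu' : wu =1 wu' -> hw_poly u wu -> hw_poly u wu'.
Proof. by move=> e [ru du xu]; split=> // a; rewrite -e. Qed.

Lemma hw_polyX u wu k : hw_poly u wu -> hw_poly (u ^+ k) (fun a => k%:R * wu a).
Proof.
move=> hu; elim: k => [|k IH].
  by rewrite expr0; apply: hw_poly_eq hw_poly1 => a; rewrite mul0r.
rewrite exprS; apply: hw_poly_eq (hw_polyM hu IH) => a.
by rewrite -natr1; ring.
Qed.

Lemma hw_poly_prod (J : Type) (r : seq J) (G : J -> P) (w : J -> 'I_m -> R) :
  (forall j, hw_poly (G j) (w j)) -> hw_poly (\prod_(j <- r) G j) (fun a => \sum_(j <- r) w j a).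
Proof.
move=> hG; elim: r => [|j r IH].
  by rewrite big_nil; apply: hw_poly_eq hw_poly1 => a; rewrite big_nil.
by rewrite big_cons; apply: hw_poly_eq (hw_polyM (hG j) IH) => a; rewrite big_cons.
Qed.

Section PowerTimesHw.
Variables (i : 'I_m) (lam : 'I_m -> R).

(** For k = 0 the truncated exponent [k.-1] is harmless, as the factor k vanishes. *)
Lemma mact_raise u wt k (a b : 'I_m) : hw_poly u wt -> (a < b)%N ->
  L a b (px R i ^+ k * u) = ((b == i)%:R * k%:R) *: (px R a * (px R i ^+ k.-1 * u)).
Proof.
move=> [ru _ _] ab; rewrite mact_xd_vder (_ : (a == b) = false); last first.
  by apply/negP => /eqP abE; rewrite abE ltnn in ab.
rewrite mulr0 scale0r addr0 vderM ru // mulr0 addr0 mulrA scalerAl; congr (_ * _).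
elim: k => [|k IH]; first by rewrite expr0 vder1 mulr0 scale0r.
rewrite exprS vderM IH vder_var lcoef_x [i == b]eq_sym -natr1.
case: k {IH} => [|k] /=; case: (b == i) => /=;
  by rewrite -!mul_mpolyC !(mpolyCD, mpolyCM, mpolyC1, mpolyC0) ?exprS; ring.
Qed.

Lemma mact_diag u wt k a : hw_poly u wt ->
  L a a (px R i ^+ k * u) = (wt a + k%:R * (a == i)%:R + c) *: (px R i ^+ k * u).
Proof.
move=> [_ du _]; rewrite mact_xd_vder eqxx mulr1 vderM du.
have -> : vder (lcoef R a a) (px R i ^+ k) = (k%:R * (a == i)%:R) *: px R i ^+ k.
  elim: k => [|k IH]; first by rewrite expr0 vder1 mul0r scale0r.
  rewrite exprS vderM IH vder_var lcoef_x [i == a]eq_sym -natr1.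
  case: eqP => [->|_]; rewrite -!mul_mpolyC !mpolyCM ?mpolyCD !mpolyC1 /=; ring.
by rewrite -!mul_mpolyC !mpolyCD; ring.
Qed.

Lemma pd_power u wt k a : hw_poly u wt ->
  pd (ix a) (px R i ^+ k * u) = ((a == i)%:R * k%:R) *: (px R i ^+ k.-1 * u).
Proof.
move=> [_ _ xu]; rewrite pdM xu mulr0 addr0 scalerAl; congr (_ * _).
elim: k => [|k IH]; first by rewrite expr0 /pd -mpolyC1 mderivC mulr0 scale0r.
rewrite exprS pdM IH pd_var [ix a == _](_ : _ = (a == i)) // -natr1.
case: k {IH} => [|k] /=; first by rewrite mulr0 scale0r mulr0 addr0 add0r mulr1 scaler_nat expr0 mulr1.
by case: (a == i); rewrite /= -!mul_mpolyC !mpolyCM !mpolyCD !mpolyC1 ?exprS ?mpolyC0; ring.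
Qed.

Lemma sum_ltn_ord q (N : nat) : (q <= N)%N -> \sum_(a < N) (a < q)%:R = q%:R :> R.
Proof.
move=> qN; have -> : q%:R = \sum_(a < N | (a < q)%N) 1 :> R.
  by rewrite -(big_ord_widen _ (fun _ => 1)) // sumr_const card_ord.
rewrite [RHS]big_mkcond.
by apply: eq_bigr => a _; case: (a < q)%N.
Qed.

Lemma mact_xdM a b (p q : P) : L a b (p * q) = vder (lcoef R a b) p * q + p * L a b q.
Proof. by rewrite !mact_xd_vder vderM mulrDr scalerAr addrA. Qed.

Lemma pd_xi_power u k : pd (ixi i) (px R i ^+ k * u) = px R i ^+ k * pd (ixi i) u.
Proof.
rewrite pdM (_ : pd _ (_ ^+ k) = 0) ?mul0r ?add0r //.
elim: k => [|k IH]; first by rewrite expr0 /pd -mpolyC1 mderivC.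
by rewrite exprS pdM IH mulr0 addr0 pd_var mul0r.
Qed.

Lemma mact_vf_E (p : P) : mact c (vf_E R m) p = \sum_a L a a p.
Proof. by rewrite -[mact c]/(act (model m c)) /vf_E actA_sum // => a; exact: slm_xd. Qed.

Lemma mact_swap (a b : 'I_m) (p : P) : L a b (L b a p) = L b a (L a b p) + (L a a p - L b b p).
Proof.
have := act_br (slm_xd R a b) (slm_xd R b a) (p : amV (model m c)).
rewrite br_xd !eqxx -(act_scaleB _ _ _ (slm_xd R a a) (slm_xd R b b)) !scale1r /= => ->.
by rewrite addrCA subrr addr0.
Qed.

(** Commutators move the raising operator to the right in each off-diagonal product, which accounts
    for the differences [lam a - lam b]. Raising w then gives something nonzero only towards the
    index i, and the off-diagonal part contributes 2k (i w + Z), where Z collects terms outside the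
    line of w. The sum of the (x_a E_x)(d/dx_a) w reduces to a = i and equals k times Z + (lam i - 1
    + e - k) w plus the d/dxi_i term. With its factor -2 it cancels Z. *)
Lemma Omega_power u wt k : hw_poly u wt -> (forall a, lam a = wt a + k%:R * (a == i)%:R + c) ->
  let e := \sum_a lam a in
  let w := px R i ^+ k * u in
  Omega (w : amV (model m c)) =
    (\sum_(a < m) \sum_(b < m) ((a == b)%:R * lam a ^+ 2 + (a < b)%N%:R * (lam a - lam b))
      + e * (e - m.+1%:R)
      + 2%:R * k%:R * (k%:R - (lam i - 1 + e - i%:R))) *: w
    - (2%:R * k%:R) *: (px R i ^+ k.-1 * pd (ixi i) u).
Proof.
move=> hu hlam e w; pose w' := px R i ^+ k.-1 * u.
have Lw a : L a a w = lam a *: w by rewrite (mact_diag _ _ hu) -hlam.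
have kw : k%:R *: (px R i * w') = k%:R *: w.
  by rewrite /w' /w; case: (k) => [|k'] /=; rewrite ?scale0r // mulrA -exprS.
pose Y b := px R b * L i b w'.
pose Z : P := \sum_(b < m) (b < i)%N%:R *: Y b.
have hraise (a b : 'I_m) : (b < a)%N ->
    L a b (L b a w) = ((a == i)%:R * k%:R) *: (w + Y b).
  move=> ba; rewrite (mact_raise _ hu ba) -/w'.
  have lZ s (p : P) : L a b (s *: p) = s *: L a b p.
    exact: (@actZ _ _ (model m c) _ (slm_xd R a b)).
  rewrite lZ; have [ai|_] := eqVneq a i; last by rewrite mul0r !scale0r.
  rewrite ai mact_xdM vder_var lcoef_x eqxx !mul1r scalerDr kw -scalerDr.
  by rewrite /Y.
have dsum : \sum_(a < m) \sum_(b < m) L a b (L b a w) =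
    (\sum_(a < m) \sum_(b < m) ((a == b)%:R * lam a ^+ 2 + (a < b)%N%:R * (lam a - lam b))) *: w
    + (2%:R * k%:R) *: (i%:R *: w + Z).
  have -> : (2%:R * k%:R) *: (i%:R *: w + Z) =
      \sum_(a < m) \sum_(b < m) (((b < a)%N%:R * (a == i)%:R * k%:R) *: (w + Y b)
        + ((a < b)%N%:R * (b == i)%:R * k%:R) *: (w + Y a)).
    have half : \sum_(a < m) \sum_(b < m) ((b < a)%N%:R * (a == i)%:R * k%:R) *: (w + Y b) =
        k%:R *: (i%:R *: w + Z).
      rewrite exchange_big /= -(sum_ltn_ord (ltnW (ltn_ord i))) scaler_suml /Z -big_split /= scaler_sumr.
      apply: eq_bigr => b _; rewrite (bigD1 i) //= eqxx big1 ?addr0 => [|a ai].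
        by rewrite -scalerDr scalerA mulr1 mulrC.
      by rewrite (negbTE ai) mulr0 mul0r scale0r.
    have -> : (2%:R * k%:R) *: (i%:R *: w + Z) =
        k%:R *: (i%:R *: w + Z) + k%:R *: (i%:R *: w + Z).
      by rewrite -scalerDl; congr (_ *: _); ring.
    under eq_bigr do rewrite big_split /=.
    rewrite big_split /=; congr (_ + _); first exact: esym half.
    by rewrite exchange_big; exact: esym half.
  rewrite scaler_suml -big_split; apply: eq_bigr => a _ /=.
  rewrite scaler_suml -big_split; apply: eq_bigr => b _ /=.
  have [ab|ba|/val_inj ab] := ltngtP a b.
  - rewrite mact_swap (hraise _ _ ab) !Lw -scalerBl.
    rewrite (_ : (a == b) = false); last by apply/negP => /eqP h; rewrite h ltnn in ab.
    by rewrite !mul0r scale0r !add0r !mul1r addrC.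
  - rewrite (hraise _ _ ba) (_ : (a == b) = false); last first.
      by apply/negP => /eqP h; rewrite h ltnn in ba.
    by rewrite !mul0r add0r !scale0r add0r addr0 mul1r.
  - rewrite -ab eqxx Lw mul1r !mul0r addr0 !scale0r !addr0.
    rewrite (_ : L a a (lam a *: w) = lam a *: L a a w); last first.
      exact: (@actZ _ _ (model m c) _ (slm_xd R a a)).
    by rewrite Lw scalerA.
have xsum : \sum_a mact c (vf_xE R a) (mact c (vf_d R a) w) =
    k%:R *: (Z + (lam i - 1 + e - k%:R) *: w + px R i ^+ k.-1 * pd (ixi i) u).
  rewrite (bigD1 i) //= big1 ?addr0 => [|a ai]; last first.
    rewrite mact_d (pd_power _ _ hu) (negbTE ai) mul0r scale0r.
    exact: (@act0 _ _ (model m c) _ (slm_xE R a)).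
  rewrite mact_d (pd_power _ _ hu) eqxx mul1r -/w'.
  rewrite (_ : mact c _ (k%:R *: w') = k%:R *: mact c (vf_xE R i) w'); last first.
    exact: (@actZ _ _ (model m c) _ (slm_xE R i)).
  case: (posnP k) => [->|k0]; first by rewrite !scale0r.
  congr (_ *: _); rewrite mact_xEE pd_xi_power; congr (_ + _).
  have wE : px R i * w' = w by rewrite /w /w' mulrA -exprS prednK.
  have hl a : L a a w' = (lam a - (a == i)%:R) *: w'.
    rewrite (mact_diag _ _ hu) hlam -[in RHS](prednK k0) -natr1; congr (_ *: _); ring.
  have -> : \sum_b L b b w' = (e - 1) *: w'.
    under eq_bigr do rewrite hl.
    rewrite -scaler_suml sumrB; congr ((_ - _) *: _).
    by rewrite (bigD1 i) //= eqxx big1 ?addr0 // => a /negbTE ->.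
  have -> : \sum_b px R b * pd (ix b) w' = (k.-1)%:R *: w'.
    rewrite (bigD1 i) //= big1 ?addr0 => [|a ai]; last first.
      by rewrite (pd_power _ _ hu) (negbTE ai) mul0r scale0r mulr0.
    rewrite (pd_power _ _ hu) eqxx mul1r -scalerAr /w'.
    by case: (k.-1) => [|k'] /=; rewrite ?scale0r // mulrA -exprS.
  have -> : \sum_b px R b * L i b w' = Z + (lam i - 1) *: w.
    have term b : px R b * L i b w' = (b < i)%N%:R *: Y b + (b == i)%:R *: ((lam i - 1) *: w).
      have [ib|bi|/val_inj <-] := ltngtP i b.
      - rewrite (mact_raise _ hu ib) eq_sym (_ : (i == b) = false).
          by rewrite mul0r !scale0r mulr0 addr0.
        by apply/negP => /eqP h; rewrite h ltnn in ib.
      - rewrite (_ : (b == i) = false); first by rewrite scale1r scale0r addr0.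
        by apply/negP => /eqP h; rewrite h ltnn in bi.
      - by rewrite eqxx hl eqxx -scalerAr wE scale0r add0r scale1r.
    under eq_bigr do rewrite term.
    rewrite big_split /=; congr (_ + _).
    rewrite (bigD1 i) //= eqxx scale1r big1 ?addr0 // => a ai.
    by rewrite (negbTE ai) scale0r.
  have -> : k%:R = (k.-1)%:R + 1 :> R by rewrite natr1 prednK.
  rewrite -wE -!mul_mpolyC !(mpolyCD, mpolyCM, mpolyCB, mpolyCN, mpolyC1); ring.
have Esum : mact c (vf_E R m) w = e *: w.
  rewrite mact_vf_E /e scaler_suml; apply: eq_bigr => a _; exact: Lw.
rewrite /Omega /= dsum xsum Esum.
have -> : mact c (vf_E R m) (e *: w - m.+1%:R *: w) = (e * (e - m.+1%:R)) *: w.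
  rewrite -scalerBl (_ : mact c _ (_ *: w) = (e - m.+1%:R) *: mact c (vf_E R m) w).
    by rewrite Esum scalerA mulrC.
  exact: (@actZ _ _ (model m c) _ (slm_E R m)).
rewrite -!mul_mpolyC !(mpolyCD, mpolyCM, mpolyCB, mpolyCN, mpolyC1); ring.
Qed.

End PowerTimesHw.
End OmegaModel.

(** * Derivations applied to determinants *)

Section DerivationOfDeterminant.
Variables (A : comNzRingType) (D : A -> A).
Hypothesis DD : forall p q, D (p + q) = D p + D q.
Hypothesis DM : forall p q, D (p * q) = D p * q + p * D q.

Lemma deriv0 : D 0 = 0.
Proof. by apply: (addrI (D 0)); rewrite -DD !addr0. Qed.

Lemma deriv1 : D 1 = 0.
Proof.
have := DM 1 1; rewrite !mulr1 mul1r => h.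
by apply: (addrI (D 1)); rewrite -h addr0.
Qed.

Lemma derivN p : D (- p) = - D p.
Proof. by apply: (addrI (D p)); rewrite -DD !subrr deriv0. Qed.

Lemma deriv_prod (J : eqType) (r : seq J) (G : J -> A) : uniq r ->
  D (\prod_(b <- r) G b) = \sum_(a <- r) \prod_(b <- r) (if b == a then D (G b) else G b).
Proof.
elim: r => [|x r IH]; first by rewrite !big_nil deriv1.
rewrite cons_uniq => /andP[xr ur]; rewrite !big_cons DM IH // eqxx.
congr (_ * _ + _).
  apply: eq_big_seq => b br.
  by case: eqP => // bx; rewrite -bx br in xr.
rewrite mulr_sumr; apply: eq_big_seq => a ar; rewrite big_cons.
by case: eqP => // xa; rewrite xa ar in xr.
Qed.

Lemma deriv_det n (M : 'M[A]_n) :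
  D (\det M) = \sum_a \det (\matrix_(b, k) if b == a then D (M b k) else M b k).
Proof.
rewrite /determinant (big_morph _ DD deriv0) exchange_big; apply: eq_bigr => s _ /=.
transitivity ((-1) ^+ perm.odd_perm s * D (\prod_b M b (s b))).
  by case: (perm.odd_perm s); rewrite ?expr1 ?expr0 ?mulN1r ?derivN // !mul1r.
rewrite deriv_prod ?index_enum_uniq // mulr_sumr; apply: eq_bigr => a _.
by congr (_ * _); apply: eq_bigr => b _; rewrite mxE.
Qed.

Lemma det_zero_row n (M : 'M[A]_n) a : (forall k, M a k = 0) -> \det M = 0.
Proof. by move=> h; rewrite (expand_det_row M a) big1 // => k _; rewrite h mul0r. Qed.

(** Such a D turns row b into t times row a and kills the other rows, so two rows coincide unless a
    = b. The case t = 0 serves for derivations that kill every entry. *)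
Lemma deriv_det_row n (M : 'M[A]_n) a b t :
  (forall e k, D (M e k) = t * (e == b)%:R * M a k) ->
  D (\det M) = t * (a == b)%:R * \det M.
Proof.
move=> h; rewrite deriv_det (bigD1 b) //= big1 ?addr0 => [|e eb]; last first.
  by apply: (@det_zero_row _ _ e) => k; rewrite mxE eqxx h (negbTE eb) mulr0 mul0r.
pose N : 'M[A]_n := \matrix_(e, k) if e == b then M a k else M e k.
rewrite (@determinant_multilinear _ _ _ N N b t 0).
- rewrite mul0r addr0 -mulrA; congr (_ * _); have [ab|ab] := eqVneq a b.
    rewrite mul1r; congr (\det _); apply/matrixP => e k; rewrite mxE.
    by case: eqP => // ->; rewrite ab.
  rewrite mul0r; apply: (determinant_alternate ab) => k.
  by rewrite !mxE eqxx (negbTE ab).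
- apply/rowP => k; rewrite !mxE eqxx h eqxx mulr1 mul0r addr0 //.
- by apply/matrixP => e k; rewrite !mxE eq_sym (negbTE (neq_lift _ _)).
- by apply/matrixP => e k; rewrite !mxE eq_sym (negbTE (neq_lift _ _)).
Qed.

End DerivationOfDeterminant.

(** * Leading minors and the chain of weight vectors *)

Section WeightVectors.
Variables (R : realType) (m : nat) (c : R) (i : 'I_m).
Notation P := {mpoly R[#|{: cidx m}|]}.

(** Completed by rows of the identity, so that the leading minor of order [j.+1] is a determinant of
    fixed size m. *)
Definition minor_mx (j : 'I_m) : 'M[P]_m :=
  \matrix_(a, k) if (a <= j)%N then py R a k else (a == k)%:R.
Definition minor j : P := \det (minor_mx j).

(* [sum_e xi_e y_e] is gl_m-invariant, hence it can replace the last row of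
   [minor i] without spoiling the highest weight property. *)
Definition contr_mx : 'M[P]_m :=
  \matrix_(a, k) if (a < i)%N then py R a k else
                 if a == i then \sum_e pxi R e * py R e k else (a == k)%:R.
Definition contr : P := \det contr_mx.

Let vD F := @vderD R (cidx m) F.
Let vM F := @vderM R (cidx m) F.

Lemma vder_bool F (b : bool) : vder F (b%:R : P) = 0.
Proof. by case: b; [exact: vder1|exact: vder0]. Qed.

Lemma pd_bool v (b : bool) : pd v (b%:R : P) = 0.
Proof. by case: b; [rewrite /pd -mpolyC1 mderivC|rewrite /pd raddf0]. Qed.

(** For a <= b the operator x_a d/dx_b puts row a in place of row b; if b <= j, then both rows
    belong to the minor. *)
Lemma hw_minor j : hw_poly (minor j) (fun a => (a <= j)%N%:R).
Proof.
have key (a b : 'I_m) : (a <= b)%N -> vder (lcoef R a b) (minor j) =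
    (b <= j)%N%:R * (a == b)%:R * minor j.
  move=> ab; apply: (deriv_det_row (vD _) (vM _)) => e k; rewrite !mxE.
  case: ifP => ej.
    rewrite vder_var lcoef_y; have [eb|_] := eqVneq e b; last by rewrite mulr0 !mul0r.
    have bj : (b <= j)%N by rewrite -eb.
    by rewrite bj (leq_trans ab bj) !mul1r.
  rewrite vder_bool; have [eb|_] := eqVneq e b; last by rewrite mulr0 mul0r.
  by rewrite -eb ej !mul0r.
split=> [a b ab|a|a].
- rewrite key ?(ltnW ab) // (_ : (a == b) = false) ?mulr0 ?mul0r //.
  by apply/negP => /eqP h; rewrite h ltnn in ab.
- by rewrite key // eqxx mulr1 scaler_nat mulr_natl.
- have -> : pd (ix a) (minor j) = 0 * (a == a)%:R * minor j; last by rewrite !mul0r.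
  apply: (deriv_det_row (pdD _) (pdM _)) => e k; rewrite !mxE !mul0r.
  by case: ifP => _; [rewrite pd_var|rewrite pd_bool].
Qed.

Lemma hw_contr : hw_poly contr (fun a => (a < i)%N%:R).
Proof.
have key (a b : 'I_m) : (a <= b)%N -> vder (lcoef R a b) contr =
    (b < i)%N%:R * (a == b)%:R * contr.
  move=> ab; apply: (deriv_det_row (vD _) (vM _)) => e k; rewrite !mxE.
  case: ifP => ei.
    rewrite vder_var lcoef_y; have [eb|_] := eqVneq e b; last by rewrite mulr0 !mul0r.
    have bi : (b < i)%N by rewrite -eb.
    by rewrite bi (leq_ltn_trans ab bi) !mul1r.
  transitivity (0 : P); last first.
    have [eb|_] := eqVneq e b; last by rewrite mulr0 mul0r.
    by rewrite -eb ei !mul0r.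
  case: ifP => _; last exact: vder_bool.
  (* On the contracted row the xi contribute -xi_b y_a and the y contribute xi_b y_a. *)
  rewrite vder_sum; under eq_bigr do rewrite vderM !vder_var lcoef_xi lcoef_y.
  rewrite big_split /=; under eq_bigr do rewrite mulNr -mulrA.
  rewrite sumrN sum_delta.
  have -> : \sum_(e0 < m) pxi R e0 * ((e0 == b)%:R * py R a k) = pxi R b * py R a k.
    by under eq_bigr do rewrite mulrCA; rewrite sum_delta.
  by rewrite addNr.
split=> [a b ab|a|a].
- rewrite key ?(ltnW ab) // (_ : (a == b) = false) ?mulr0 ?mul0r //.
  by apply/negP => /eqP h; rewrite h ltnn in ab.
- by rewrite key // eqxx mulr1 scaler_nat mulr_natl.
- have -> : pd (ix a) contr = 0 * (a == a)%:R * contr; last by rewrite !mul0r.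
  apply: (deriv_det_row (pdD _) (pdM _)) => e k; rewrite !mxE !mul0r.
  case: ifP => _; first by rewrite pd_var.
  case: ifP => _; last exact: pd_bool.
  by rewrite pd_sum big1 // => e' _; rewrite pdM !pd_var mul0r mulr0 addr0.
Qed.

Lemma pd_xi_minor j : pd (ixi i) (minor j) = 0.
Proof.
have -> : pd (ixi i) (minor j) = 0 * (j == j)%:R * minor j; last by rewrite !mul0r.
apply: (deriv_det_row (pdD _) (pdM _)) => e k; rewrite !mxE !mul0r.
by case: ifP => _; [rewrite pd_var|rewrite pd_bool].
Qed.

(** Only the contracted row depends on xi_i, and its derivative is the i-th row of y. *)
Lemma pd_xi_contr : pd (ixi i) contr = minor i.
Proof.
rewrite (deriv_det (pdD _) (pdM _)) (bigD1 i) //= big1 ?addr0 => [|a ai]; last first.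
  apply: (@det_zero_row _ _ _ a) => k; rewrite !mxE eqxx (negbTE ai).
  by case: ifP => _; [rewrite pd_var|rewrite pd_bool].
congr (\det _); apply/matrixP => a k; rewrite !mxE.
have [->|ai] := eqVneq a i.
  rewrite ltnn leqnn pd_sum (bigD1 i) //= big1 ?addr0 => [|e ei].
    by rewrite pdM !pd_var eqxx mul1r mulr0 addr0.
  by rewrite pdM !pd_var mulr0 addr0 (_ : (ixi i == ixi e) = false) ?mul0r // eq_sym -(negbTE ei).
by rewrite [(a <= i)%N]leq_eqVlt (negbTE (ai : (a != i :> nat))).
Qed.

Lemma minor_neq0 j : minor j != 0.
Proof.
(* The point at which y is the identity matrix; every leading minor takes the value 1 there. *)
pose v (t : 'I_#|{: cidx m}|) : R := if enum_val t is inr (a, k) then (a == k)%:R else 0.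
suff : meval v (minor j) = 1.
  by move=> h; apply/eqP => h0; move: h; rewrite h0 raddf0 => /esym/eqP; rewrite oner_eq0.
rewrite /minor -det_map_mx (_ : map_mx _ _ = 1%:M) ?det1 //; apply/matrixP => a k.
rewrite !mxE; case: ifP => _; first by rewrite /= /py /var mevalXU /v enum_rankK.
by case: eqP => _; rewrite ?rmorph1 ?rmorph0.
Qed.

Variables (n : nat) (ex : 'I_m -> nat).

Definition minors : P := \prod_j minor j ^+ ex j.
(** Passing from k to k + 1 exchanges a factor [minor i] for [contr], which loses the i-th unit of
    weight; the extra factor x_i in [chain] restores it. Hence [chain_wt] does not depend on k. *)
Definition chain_poly k : P := contr ^+ k * minor i ^+ (n - k) * minors.
Definition chain k : P := px R i ^+ k * chain_poly k.
Definition chain_wt (a : 'I_m) : R :=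
  n%:R * (a <= i)%N%:R + \sum_j (ex j)%:R * (a <= j)%N%:R + c.

Lemma hw_chain_poly k : hw_poly (chain_poly k)
  (fun a => k%:R * (a < i)%N%:R + (n - k)%:R * (a <= i)%N%:R + \sum_j (ex j)%:R * (a <= j)%N%:R).
Proof.
apply: hw_polyM; last by apply: hw_poly_prod => j; apply: hw_polyX; exact: hw_minor.
by apply: hw_polyM; apply: hw_polyX; [exact: hw_contr|exact: hw_minor].
Qed.

Lemma chain_wtE k (a : 'I_m) : (k <= n)%N -> chain_wt a =
  k%:R * (a < i)%N%:R + (n - k)%:R * (a <= i)%N%:R + \sum_j (ex j)%:R * (a <= j)%N%:R
  + k%:R * (a == i)%:R + c.
Proof.
move=> kn; have -> : (a <= i)%N%:R = (a < i)%N%:R + (a == i)%:R :> R.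
  rewrite leq_eqVlt -[(a == i)]/(a == i :> nat); case: ltngtP => //= _; ring.
by rewrite /chain_wt leq_eqVlt -[(a == i)]/(a == i :> nat) natrB //; case: ltngtP => //= _; ring.
Qed.

Lemma minors_neq0 : minors != 0.
Proof. by apply/prodf_neq0 => j _; rewrite expf_neq0 // minor_neq0. Qed.

Lemma chain0_neq0 : chain 0 != 0.
Proof. by rewrite /chain /chain_poly !expr0 !mul1r mulf_neq0 ?expf_neq0 ?minor_neq0 ?minors_neq0. Qed.

Lemma pd_xi_chain_poly k : (0 < k <= n)%N ->
  pd (ixi i) (chain_poly k) = k%:R *: chain_poly k.-1.
Proof.
case: k => // k /= kn.
have pX p l : pd (ixi i) p = 0 -> pd (ixi i) (p ^+ l) = 0 :> P.
  move=> hp; elim: l => [|l IH]; first by rewrite expr0 /pd -mpolyC1 mderivC.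
  by rewrite exprS pdM IH hp mul0r mulr0 addr0.
have hm : pd (ixi i) minors = 0.
  rewrite /minors; elim/big_ind: _ => [|p q hp hq|j _].
  - by rewrite /pd -mpolyC1 mderivC.
  - by rewrite pdM hp hq mul0r mulr0 addr0.
  - by apply: pX; exact: pd_xi_minor.
have hc l : pd (ixi i) (contr ^+ l.+1) = l.+1%:R *: (contr ^+ l * minor i).
  elim: l => [|l IH]; first by rewrite expr1 expr0 mul1r scale1r pd_xi_contr.
  rewrite exprS pdM IH pd_xi_contr -(natr1 l.+1) -!mul_mpolyC !(mpolyCD, mpolyC1) exprS; ring.
rewrite /chain_poly !pdM hm hc (pX (minor i)) ?pd_xi_minor // !mulr0 !addr0.
by rewrite -(subnSK kn) exprS -!mul_mpolyC; ring.
Qed.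

Definition casimir_value : R :=
  let e := \sum_a chain_wt a in
  \sum_(a < m) \sum_(b < m) ((a == b)%:R * chain_wt a ^+ 2 + (a < b)%N%:R * (chain_wt a - chain_wt b))
  + e * (e - m.+1%:R).

(** Precisely the condition under which the k-dependent coefficient in [Omega_power] becomes 2k(k -
    n). *)
Hypothesis n_eq : n%:R = chain_wt i - 1 + \sum_a chain_wt a - i%:R.

Lemma Omega_chain k : (k <= n)%N ->
  Omega (chain k : amV (model m c)) =
    (casimir_value + 2%:R * k%:R * (k%:R - n%:R)) *: chain k - (2%:R * k%:R ^+ 2) *: chain k.-1.
Proof.
move=> kn; rewrite (Omega_power (hw_chain_poly k) (fun a => chain_wtE a kn)) -n_eq.
congr (_ - _); have [->|k0] := posnP k; first by rewrite mulr0 expr0n mulr0 !scale0r.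
rewrite pd_xi_chain_poly ?k0 // -scalerAr scalerA; congr (_ *: _); ring.
Qed.

Lemma hw_chain0 lam : (forall a, lam (lift ord0 a) = chain_wt a) ->
  hw_vector lam (chain 0 : amV (model m c)).
Proof.
move=> hlam; have hu := hw_chain_poly 0; split=> [a|b|a b ab] /=.
- rewrite (mact_diag c i 0 a hu) hlam; congr (_ *: _).
  by rewrite (chain_wtE _ (leq0n n)).
- by rewrite mact_d (pd_power i 0 b hu) mulr0 scale0r.
- by rewrite (mact_raise c i 0 hu ab) mulr0 scale0r.
Qed.

(* The coefficient [2k(k-n)] vanishes only at [k = 0] and [k = n]: starting from
   [chain n], the term in [chain k] is removed for [k = n-1, ..., 1] in turn. *)
Lemma jordan_vector : (0 < n)%N -> exists (x : amV (model m c)) (al : R), al != 0 /\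
  Omega x = casimir_value *: x + al *: (chain 0 : amV (model m c)).
Proof.
move=> n0; pose T (x : amV (model m c)) := Omega x - casimir_value *: x.
suff [x [al [al0 hx]]] : exists (x : amV (model m c)) (al : R), al != 0 /\ T x = al *: chain 0.
  by exists x, al; split=> //; rewrite -hx /T addrC subrK.
have TP a u v : T (a *: u + v) = a *: T u + T v.
  rewrite /T OmegaP; move: (Omega u) (Omega v) => Ou Ov.
  by rewrite [casimir_value *: _]scalerDr opprD addrACA [a *: (_ - _)]scalerBr !scalerA [a * _]mulrC.
suff H k : (k < n)%N -> exists (x : amV (model m c)) (al : R), al != 0 /\
    T x = al *: chain (n.-1 - k)%N.
  by have := H n.-1; rewrite subnn prednK // leqnn; apply.
have Tch l : (l <= n)%N -> T (chain l) =
    (2%:R * l%:R * (l%:R - n%:R)) *: chain l - (2%:R * l%:R ^+ 2) *: chain l.-1.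
  move=> ln; rewrite /T Omega_chain // addrAC; congr (_ - _).
  by rewrite scalerDl addrAC subrr add0r.
elim: k => [|k IH] kn.
  exists (chain n), (- (2%:R * n%:R ^+ 2)); split.
    by rewrite oppr_eq0 mulf_neq0 ?pnatr_eq0 // expf_neq0 // pnatr_eq0 -lt0n.
  by rewrite Tch // subrr mulr0 scale0r add0r subn0 scaleNr.
have [x [al [al0 hx]]] := IH (ltnW kn).
set l := (n.-1 - k)%N in hx.
have l0 : (0 < l)%N by rewrite subn_gt0 -ltnS prednK.
have ln : (l < n)%N by rewrite -[X in (_ < X)%N](prednK n0) ltnS leq_subr.
have -> : (n.-1 - k.+1)%N = l.-1 by rewrite subnS.
pose d : R := 2%:R * l%:R * (l%:R - n%:R).
have d0 : d != 0.
  rewrite /d !mulf_neq0 ?pnatr_eq0 -?lt0n // subr_eq0 eqr_nat.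
  by rewrite neq_ltn ln.
exists (- (al / d) *: chain l + x), (al / d * (2%:R * l%:R ^+ 2)); split.
  by rewrite !mulf_neq0 ?invr_eq0 ?expf_neq0 ?pnatr_eq0 -?lt0n.
rewrite TP hx Tch ?(ltnW ln) // -/d scalerBr !scalerA mulNr divfK // scaleNr.
by rewrite addrAC addNr add0r mulNr scaleNr opprK.
Qed.

End WeightVectors.

(** * Non-semisimplicity *)

Section ShiftedWeight.
Variables (R : realType) (m : nat) (mu : weight R m) (i : 'I_m).
Hypotheses (mu_wt : is_weight mu) (mu_dom : dom_int mu).

Let f k := mu (inord k).

(** On the gl_m-coordinates the linked weight lists the entries of mu after [mu 0] was moved in and
    the entry of index i + 1 left out; the entries moved one place to the right gain 1 from rho. *)
Lemma shift_wtE (a : 'I_m) :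
  shift_wt mu i (lift ord0 a) = mu (lift (lift ord0 i) a) + (a <= i)%N%:R.
Proof.
rewrite /shift_wt /rho /= /bump leq0n add1n /= ltnS.
have am := ltn_ord a; have [ai|ai] := leqP a i.
  rewrite inordK ?(ltnW (ltn_ord _)) //; last by rewrite ltnS ltnW.
  have -> : inord a = lift (lift ord0 i) a.
    by apply: val_inj; rewrite /= inordK ?ltnS ?(ltnW am) // /bump leq0n add1n ltnNge ai.
  by rewrite -(natr1 a) /=; ring.
have -> : inord a.+1 = lift (lift ord0 i) a.
  by apply: val_inj; rewrite /= inordK ?ltnS // /bump leq0n add1n ai add1n.
by rewrite /= /bump leq0n add1n ai add1n; ring.
Qed.

Lemma sum_shift_wt : \sum_a shift_wt mu i (lift ord0 a) = i.+1%:R - mu (lift ord0 i).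
Proof.
under eq_bigr do rewrite shift_wtE.
rewrite big_split /= (sum_ltn_ord R (ltn_ord i)).
have := mu_wt; rewrite /is_weight (bigD1_ord (lift ord0 i)) //= => /eqP.
by rewrite addr_eq0 => /eqP ->; ring.
Qed.

(** Once [mu ord_max] is subtracted the weight is a partition, and the multiplicity of each leading
    minor is the drop between consecutive entries, the last one being compared with 0. The drop at i
    contains [mu i - mu (i+1) + 1], which is n; the remainder is [ex i]. The 1 coming from rho makes
    n positive. *)
Lemma shift_wt_chain : exists (n : nat) (ex : 'I_m -> nat), [/\ (0 < n)%N,
  forall a, shift_wt mu i (lift ord0 a) = chain_wt (mu ord_max) i n ex a &
  n%:R = shift_wt mu i (lift ord0 i) - 1 + \sum_a shift_wt mu i (lift ord0 a) - i%:R].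
Proof.
have [D hD] : exists D : nat -> nat, forall k, (k < m)%N -> f k - f k.+1 = (D k)%:R.
  have hk k : exists d : nat, (k < m)%N -> f k - f k.+1 = d%:R.
    have [km|] := boolP (k < m)%N; last by exists 0%N.
    have [d hd] := mu_dom (Ordinal km); exists d => _; rewrite -hd; congr (mu _ - mu _).
      by apply: val_inj; rewrite /= inordK // ltnS ltnW.
    by apply: val_inj; rewrite /= inordK // ltnS.
  by exists (fun k => projT1 (cid (hk k))) => k; case: cid.
(* From i on the drops of mu are read one place further, because the entry of index i + 1 is left
   out; beyond the last drop the value is 0. *)
pose E j := if (j < i)%N then D j else if (j.+1 < m)%N then D j.+1 else 0%N.
have fv (k : 'I_m.+1) : mu k = f k by rewrite /f inord_val.
exists (D i).+1, (fun j : 'I_m => E j); split=> //; last first.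
  rewrite sum_shift_wt shift_wtE leqnn -(natr1 (D i)) -hD // -(natr1 i) !fv /=.
  by rewrite /bump leq0n add1n ltnn add0n; ring.
pose g a : R := \sum_(j < m) (E j)%:R * (a <= j)%N%:R.
have gS a : (a < m)%N -> g a = g a.+1 + (E a)%:R.
  move=> am; rewrite /g (bigD1 (Ordinal am)) //= [in RHS](bigD1 (Ordinal am)) //= leqnn ltnn.
  rewrite mulr1 mulr0 add0r addrC; congr (_ + _); apply: eq_bigr => j ja.
  have {}ja : (a != j)%N by apply: contra ja => /eqP ja; apply/eqP/val_inj.
  by rewrite (leq_eqVlt a j) (negbTE ja).
have gm : g m = 0.
  by rewrite /g big1 // => j _; rewrite leqNgt ltn_ord mulr0.
pose t a : R := if (a <= i)%N then f a + 1 else f a.+1.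
have tP (a : 'I_m) : shift_wt mu i (lift ord0 a) = t a.
  rewrite shift_wtE fv /t /= /bump leq0n add1n ltnNge; case: leqP => ai /=; last by rewrite addr0.
  by [].
have cv : mu ord_max = f m by rewrite fv.
(* Both sides telescope, so the identity is proved from the last row upwards; k counts the rows
   below b. *)
suff h k : forall b, (b + k.+1)%N = m -> (D i).+1%:R * (b <= i)%N%:R + g b + f m = t b.
  move=> a; rewrite tP /chain_wt cv -(h (m - a.+1)%N a) //.
  by rewrite addnS -addSn subnKC.
elim: k => [|k IH] b bm.
  have {}bm : b.+1 = m by rewrite -bm addn1.
  have bi : (b < i)%N = false by rewrite ltnNge -ltnS bm ltn_ord.
  rewrite gS -?bm // bm gm /E bi bm ltnn addr0 /t; case: leqP => ib.
    have bE : b = i by apply/eqP; rewrite eqn_leq ib leqNgt bi.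
    have fE : f i.+1 = f m by rewrite -bE bm.
    by rewrite bE -(natr1 (D i)) -hD // fE /=; ring.
  by rewrite mulr0 !add0r bm.
have bm1 : (b.+1 + k.+1)%N = m by rewrite addSnnS.
have b1m : (b.+1 < m)%N by rewrite -bm1 addnS ltnS leq_addr.
have := IH _ bm1; rewrite (gS b (ltnW b1m)) /t /E b1m.
have [bi|ib|bi] := ltngtP b i.
- rewrite /= mulr1 => h.
  have -> : g b.+1 = f b.+1 + 1 - f m - (D i).+1%:R by rewrite -h; ring.
  by rewrite -hD ?(ltnW b1m) //; ring.
- rewrite /= mulr0 => h; have -> : g b.+1 = f b.+2 - f m by rewrite -h; ring.
  by rewrite -hD //; ring.
- rewrite /= mulr0 => h; have -> : g b.+1 = f b.+2 - f m by rewrite -h; ring.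
  by rewrite -hD // -(natr1 (D i)) -bi -hD ?(ltnW b1m) //; ring.
Qed.

End ShiftedWeight.

Section ProductAmod.
Variables (R : realType) (m : nat) (M N : amod R m).

Definition prod_act (A : Mat R m) (u : (amV M * amV N)%type) : (amV M * amV N)%type :=
  (act M A u.1, act N A u.2).

Fact prod_act_linV A : slm A -> forall (a : R) (u v : (amV M * amV N)%type),
  prod_act A (a *: u + v) = a *: prod_act A u + prod_act A v.
Proof. by move=> hA a [u1 u2] [v1 v2]; rewrite /prod_act /= !act_linV. Qed.

Fact prod_act_linA A B : slm A -> slm B -> forall (a : R) (v : (amV M * amV N)%type),
  prod_act (a *: A + B) v = a *: prod_act A v + prod_act B v.
Proof. by move=> hA hB a [v1 v2]; rewrite /prod_act /= !act_linA. Qed.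

Fact prod_act_br A B : slm A -> slm B -> forall v : (amV M * amV N)%type,
  prod_act (A *m B - B *m A) v = prod_act A (prod_act B v) - prod_act B (prod_act A v).
Proof. by move=> hA hB [v1 v2]; rewrite /prod_act /= !act_br. Qed.

Definition prod_amod : amod R m := AMod prod_act_linV prod_act_linA prod_act_br.

End ProductAmod.

(* The submodule of [L * X] generated by the pair of highest weight vectors is
   the graph of the map: it meets [L * 0] in a submodule of the simple module [L]
   which does not contain [vL], because the weight of the pair has multiplicity
   one. *)
Lemma hw_quotient (R : realType) (m : nat) (L X : amod R m) (lam : weight R m)
    (vL : amV L) (vX : amV X) :
  simple_mod L -> hw_vector lam vL -> hw_vector lam vX -> vL != 0 -> vX != 0 ->
  exists pi : amV (sub_amod (cyclic_sub_submod vX)) -> amV L, amhom pi /\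
    forall u, val u = vX -> pi u = vL.
Proof.
move=> [_ simL] [wL dL nL] [wX dX nX] vL0 vX0.
pose z : amV (prod_amod L X) := (vL, vX); pose G := cyclic_sub z.
have [sG aG] : submod G by exact: cyclic_sub_submod.
have hz : hw_vector lam z.
  split=> [a|b|a b ab]; rewrite /= /prod_act /=.
  - by rewrite wL wX.
  - by rewrite dL dX.
  - by rewrite nL // nX.
have G0 a : G (a, 0) -> a = 0.
  have sK : submod (fun a => G (a, 0)).
    split; first split; first exact: sG.1.
    + move=> s a' b ha hb; have := sG.2 s _ _ ha hb.
      by rewrite (_ : _ + _ = (s *: a' + b, s *: (0 : amV X) + 0)) // scaler0 addr0.
    + by move=> A hA a' ha; have := aG A hA _ ha; rewrite /= /prod_act /= act0.
  have [K0|KT] := simL _ sK; first exact: K0.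
  have [|r] := hw_space_line hz (KT vL).
    move=> a'; rewrite /= /prod_act /= wL (@act0 _ _ X _ (slm_xd R a' a')).
    by rewrite (_ : lam (lift ord0 a') *: (vL, 0) = (lam (lift ord0 a') *: vL, lam (lift ord0 a') *: (0 : amV X))) // scaler0.
  move=> [e1 /esym/eqP]; rewrite scaler_eq0 (negbTE vX0) orbF => /eqP r0.
  by move: vL0; rewrite e1 r0 scale0r eqxx.
have uniqG a b p : G (a, p) -> G (b, p) -> a = b.
  move=> ha hb; apply/eqP; rewrite -subr_eq0; apply/eqP/G0.
  by have := subspaceB sG ha hb; rewrite (_ : _ - _ = (a - b, p - p)) // subrr.
have exG (u : amV (sub_amod (cyclic_sub_submod vX))) : exists a, G (a, val u).
  apply: (sub_valS u (fun p => exists a, G (a, p))); last by exists vL.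
  split; first split; first by exists 0; exact: sG.1.
  - by move=> s p q [a ha] [b hb]; exists (s *: a + b); exact: (sG.2 s _ _ ha hb).
  - by move=> A hA p [a ha]; exists (act L A a); exact: (aG A hA _ ha).
pose pi u := projT1 (cid (exG u)).
have piP u : G (pi u, val u) by rewrite /pi; case: cid.
exists pi; split; first split.
- move=> a u v; apply: (uniqG _ _ _ (piP _)); rewrite linearP.
  exact: (sG.2 a _ _ (piP u) (piP v)).
- move=> A hA v; apply: (uniqG _ _ _ (piP _)); rewrite val_sub_act //.
  exact: (aG A hA _ (piP v)).
- by move=> u uv; apply: (uniqG _ _ _ (piP u)); rewrite uv.
Qed.

Lemma submod_Omega (R : realType) (m : nat) (M : amod R m) (S : amV M -> Prop) (v : amV M) :
  submod S -> S v -> S (Omega v).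
Proof.
move=> [sS aS] Sv; rewrite /Omega.
apply: (subspaceB sS); first apply: (subspaceD sS).
- apply: (subspace_sum _ sS) => a _; apply: (subspace_sum _ sS) => b _.
  by apply: (aS _ (slm_xd R a b)); apply: (aS _ (slm_xd R b a)).
- apply: (aS _ (slm_E R m)); apply: (subspaceB sS); last exact: (subspaceZ sS).
  exact: (aS _ (slm_E R m)).
- apply: (subspaceZ sS); apply: (subspace_sum _ sS) => a _.
  by apply: (aS _ (slm_xE R a)); apply: (aS _ (slm_d R a)).
Qed.

Lemma val_amhom (R : realType) (m : nat) (M : amod R m) (S : amV M -> Prop) (HS : submod S) :
  amhom (val : amV (sub_amod HS) -> amV M).
Proof. by split=> [a u v|A hA v]; [rewrite linearP|rewrite val_sub_act]. Qed.

(** Omega - c sends y to al t, a nonzero vector that it kills; on a sum of eigenvectors this is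
    excluded by [eigen_sum_ker]. *)
Lemma jordan_not_semisimple (R : realType) (m : nat) (M : amod R m) (c al : R) (y t : amV M) :
  al != 0 -> t != 0 -> Omega y = c *: y + al *: t -> Omega t = c *: t -> ~ Omega_semisimple M.
Proof.
move=> al0 t0 hy ht ss; have [n [d [w [hw yw]]]] := ss y.
pose T (u : amV M) := Omega u - c *: u.
have TP (a : R) u v : T (a *: u + v) = a *: T u + T v.
  rewrite /T OmegaP; move: (Omega u) (Omega v) => Ou Ov.
  by rewrite [c *: _]scalerDr opprD addrACA [a *: (_ - _)]scalerBr !scalerA [a * _]mulrC.
have Ty : T y = al *: t by rewrite /T hy addrAC subrr add0r.
have Tt : T t = 0 by rewrite /T ht subrr.
have T0 : T 0 = 0.
  by have := TP 1 0 0; rewrite !scale1r addr0 => h; apply: (addrI (T 0)); rewrite addr0.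
have := eigen_sum_ker TP (c := fun k => d k - c) (w := w).
rewrite -yw Ty => h; have : al *: t = 0.
  apply: h => [k|]; first by rewrite /T hw scalerBl.
  by have := TP al t 0; rewrite T0 !addr0 Tt scaler0.
by move=> /eqP; rewrite scaler_eq0 (negbTE al0) (negbTE t0).
Qed.

Theorem mainTheorem16 (R : realType) (m : nat) (mu : weight R m) (i : 'I_m)
    (L I : amod R m) (j : amV L -> amV I) :
  is_weight mu -> dom_int mu ->
  (* L is the irreducible module of highest weight mu[i] in O^{b_m}(a_m) *)
  inO L -> simple_mod L -> has_hw L (shift_wt mu i) ->
  (* I is an injective envelope of L in O^{b_m}(a_m) *)
  inj_obj I -> amhom j -> injective j -> essential j ->
  ~ Omega_semisimple I.
Proof.
move=> muW muD _ simL [vL [vL0 [wL [dL nL]]]] [_ injI] hj jinj _.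
have hL : hw_vector (shift_wt mu i) vL by [].
have [n [ex [n0 wtE nE]]] := shift_wt_chain i muW muD.
set c := mu ord_max in wtE.
have n_eq : n%:R = chain_wt c i n ex i - 1 + \sum_a chain_wt c i n ex a - i%:R.
  by rewrite -wtE nE; under eq_bigr do rewrite wtE.
pose X := model m c; pose vX : amV X := chain R i n ex 0.
have vX0 : vX != 0 by exact: chain0_neq0.
have hX : hw_vector (shift_wt mu i) vX by exact: hw_chain0.
have [x [al [al0 hx]]] := jordan_vector n_eq n0.
set cv := casimir_value _ _ _ _ in hx.
have OvX : Omega vX = cv *: vX.
  by rewrite (Omega_chain n_eq (leq0n n)) mulr0 mul0r addr0 expr0n mulr0 scale0r subr0.
pose sM := cyclic_sub_submod vX; pose sN := cyclic_sub_submod (x : amV X).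
have xvX : cyclic_sub (x : amV X) vX.
  have -> : vX = al^-1 *: (Omega (x : amV X) - cv *: x).
    by rewrite hx addrAC subrr add0r scalerA mulVf // scale1r.
  apply: (subspaceZ sN.1); apply: (subspaceB sN.1); last exact: (subspaceZ sN.1).
  exact: (submod_Omega sN).
have incl u : cyclic_sub vX u -> cyclic_sub (x : amV X) u by move=> hu; exact: (hu _ sN xvX).
have [pi [hpi pivX]] := hw_quotient simL hL hX vL0 vX0.
pose f (u : amV (sub_amod sM)) : amV (sub_amod sN) := mk_sub sN (incl _ (sub_valS u)).
have valf u : val (f u) = val u by [].
have hf : amhom f.
  split=> [a u v|A hA v]; apply: val_inj; first by rewrite valf linearP [RHS]linearP.
  by transitivity (act X A (val v)); [exact: (val_sub_act v hA)|exact: (esym (val_sub_act (f v) hA))].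
have finj : injective f by move=> u v /(congr1 val); rewrite !valf => /val_inj.
have hg : amhom (j \o pi).
  split=> [a u v|A hA v] /=; first by rewrite hpi.1 hj.1.
  by rewrite hpi.2 // hj.2.
have [h [hh hfE]] := injI _ _ f (j \o pi) (cyclic_inO vX) (cyclic_inO x) hf finj hg.
pose gM : amV (sub_amod sM) := mk_sub sM (@cyclic_sub_gen _ _ X vX).
pose gN : amV (sub_amod sN) := mk_sub sN (@cyclic_sub_gen _ _ X x).
have vM := val_amhom sM; have vN := val_amhom sN.
have OgM : Omega gM = cv *: gM.
  by apply: val_inj; rewrite (Omega_amhom vM) linearZ /= OvX.
have OgN : Omega gN = cv *: gN + al *: f gM.
  by apply: val_inj; rewrite (Omega_amhom vN) linearD !linearZ /= hx.
have tE : h (f gM) = j vL by rewrite hfE /= pivX.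
(* The Jordan block in I is spanned by the images under h of x and of vX, the latter being
   [j vL]. *)
apply: (@jordan_not_semisimple _ _ _ cv al (h gN) (j vL)) => //.
- by apply/eqP => jv; move/eqP: vL0; apply; apply: jinj; rewrite (amhom0 hj).
- by rewrite -(Omega_amhom hh) OgN (amhomD hh) !(amhomZ hh) tE.
- rewrite -tE hfE -(Omega_amhom hg) OgM.
  exact: (amhomZ hg).
Qed.
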